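(* Let $G$ be a finitely presented group that is synchronously or asynchronously automatic, and let $\phi:G\to Q$ be a homomorphism to a finitely generated abelian group $Q$ such that the kernel $N:=\ker(\phi)$ is finitely presented. Then there is a constant $C>1$ such that the Dehn function of $N$ satisfies $\delta_N(n)\leq C^n$ for all $n$.
   Context: Let $H$ be a group with finite presentation $\mathcal{P}=\langle X\mid R\rangle$ and let $F_X$ be the free group on $X$. A word $w$ in $X^{\pm 1}$ is null-homotopic if it represents the trivial element of $H$. Its area $\mathrm{Area}_{\mathcal{P}}(w)$ is the minimal $k$ such that in $F_X$ one has $w=\prod_{i=1}^k u_i r_i u_i^{-1}$ with $r_i\in R^{\pm1}$ and $u_i\in F_X$. The Dehn function of $H$ with respect to $\mathcal{P}$ is $\delta_{H,\mathcal{P}}(n):=\max\{\mathrm{Area}_{\mathcal{P}}(w)\mid w \text{ null-homotopic},\ \ell(w)\leq n\}$, where $\ell(w)$ is the length of $w$. One writes $\delta_H$ for $\delta_{H,\mathcal{P}}$ with respect to a finite presentation; up to the equivalence $f_1\asymp f_2$ (meaning $f_1\preccurlyeq f_2\preccurlyeq f_1$, where $f_1\preccurlyeq f_2$ if there is $C\geq1$ with $f_1(n)\leq Cf_2(Cn+C)+Cn+C$ for all $n$) it does not depend on the finite presentation. Synchronously and asynchronously automatic groups are meant in the standard sense of Epstein, Cannon, Holt, Levy, Paterson and Thurston. *)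

(* Defs.v *)
From HB Require Import structures.
From mathcomp Require Import all_boot all_order all_algebra.
From mathcomp Require Import boolp reals.

Set Implicit Arguments.
Unset Strict Implicit.
Unset Printing Implicit Defensive.

Local Open Scope group_scope.

(* A letter (x, false) stands for x and (x, true) for x^-1.  The free group
   F_X is the set of words modulo free_eq. *)
Definition word (X : Type) := seq (X * bool).

Section Words.
Variable X : Type.
Implicit Types (u v w : word X).

Definition letter_inv (l : X * bool) : X * bool := (l.1, ~~ l.2).

Definition word_inv w : word X := rev (map letter_inv w).

Inductive free_eq : word X -> word X -> Prop :=
| free_eq_refl w : free_eq w w
| free_eq_sym u v : free_eq u v -> free_eq v u
| free_eq_trans u v w : free_eq u v -> free_eq v w -> free_eq u w
| free_eq_cancel u v l : free_eq (u ++ [:: l; letter_inv l] ++ v) (u ++ v).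

Definition word_eval (H : groupType) (f : X -> H) w : H :=
  \prod_(l <- w) (if l.2 then (f l.1)^-1 else f l.1).

End Words.

(* In F_X, w is a product of k conjugates u r u^-1 with r in R^{+-1}; the list
   s holds the k pairs (u, r). *)
Definition relator_product (X : eqType) (R : seq (word X)) (k : nat)
    (w : word X) : Prop :=
  exists s : seq (word X * word X),
    [/\ size s = k,
        forall u r, (u, r) \in s -> r \in R ++ map (@word_inv X) R
      & free_eq w (flatten [seq p.1 ++ p.2 ++ word_inv p.1 | p <- s])].

(* The last field says that the kernel of F_X -> H is the normal closure
   of R. *)
Record finite_presentation (H : groupType) := FinitePresentation {
  generator : finType;
  relators : seq (word generator);
  gen_val : generator -> H;
  gen_val_generates : forall h : H, exists w, word_eval gen_val w = h;
  gen_val_relations : forall w,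
    word_eval gen_val w = 1 <-> exists k, relator_product relators k w
}.

Definition finitely_presented (H : groupType) : Prop :=
  inhabited (finite_presentation H).

Definition finitely_generated (H : groupType) : Prop :=
  exists (X : finType) (f : X -> H), forall h : H, exists w, word_eval f w = h.

Definition abelian_group (H : groupType) : Prop :=
  forall x y : H, commute x y.

Section DehnFunction.
Variables (H : groupType) (P : finite_presentation H).

Definition null_homotopic (w : word (generator P)) : Prop :=
  word_eval (@gen_val H P) w = 1.

(* The value 0 on words that are not null-homotopic is a dummy. *)
Definition area (w : word (generator P)) : nat :=
  if pselect (exists k, `[< relator_product (relators P) k w >]) is left e
  then ex_minn e else 0.

Definition dehn (n : nat) : nat :=
  \max_(m < n.+1)
    \max_(w : m.-tuple (generator P * bool) | `[< null_homotopic w >]) area w.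

End DehnFunction.

Section Kernel.
Variables (G Q : groupType) (phi : {multiplicative G -> Q}).

Definition ker_pred : pred G := fun x => phi x == 1.

Lemma ker_group_closed : group_closed ker_pred.
Proof.
have phi1 : phi 1 = 1.
  by apply: (mulgI (phi 1)); rewrite -gmulfM !mulg1.
have phiV x : phi x^-1 = (phi x)^-1.
  by apply: (mulgI (phi x)); rewrite -gmulfM !mulgV.
split; first by rewrite /in_mem /= /ker_pred phi1.
move=> x y; rewrite /in_mem /= /ker_pred gmulfM phiV => /eqP -> /eqP ->.
by rewrite mulgV.
Qed.

Record kernel := Kernel { ker_val : G; _ : ker_pred ker_val }.

HB.instance Definition _ := [isSub for ker_val].
HB.instance Definition _ := [Choice of kernel by <:].
HB.instance Definition _ :=
  SubChoice_isSubGroup.Build G ker_pred kernel ker_group_closed.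

End Kernel.

Record dfa (A : Type) := Dfa {
  dfa_state : finType;
  dfa_start : dfa_state;
  dfa_accept : {set dfa_state};
  dfa_trans : dfa_state -> A -> dfa_state
}.

Definition dfa_lang (A : Type) (M : dfa A) (w : seq A) : bool :=
  foldl (@dfa_trans A M) (dfa_start M) w \in dfa_accept M.

(* The shorter of the two words is padded at the end with the symbol None. *)
Definition pad (A : Type) (w1 w2 : seq A) : seq (option A * option A) :=
  mkseq (fun i => (onth w1 i, onth w2 i)) (maxn (size w1) (size w2)).

(* Asynchronous deterministic two-tape automata.  A state reads its next symbol
   from the left tape when async_left holds, and from the right tape
   otherwise; the symbol None is the end-of-tape marker. *)
Record async_dfa (A : Type) := AsyncDfa {
  async_state : finType;
  async_start : async_state;
  async_accept : {set async_state};
  async_left : pred async_state;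
  async_trans : async_state -> option A -> option async_state
}.

Section AsyncRun.
Variables (A : Type) (M : async_dfa A).

Inductive async_run :
    async_state M -> seq (option A) -> seq (option A) -> Prop :=
| async_stop q : q \in async_accept M -> async_run q [::] [::]
| async_read_left q q' a s t :
    async_left q -> async_trans q a = Some q' ->
    async_run q' s t -> async_run q (a :: s) t
| async_read_right q q' a s t :
    ~~ async_left q -> async_trans q a = Some q' ->
    async_run q' s t -> async_run q s (a :: t).

Definition async_lang (w1 w2 : seq A) : Prop :=
  async_run (async_start M)
    (rcons (map Some w1) None) (rcons (map Some w2) None).

End AsyncRun.

(* The clause common to both kinds of automatic structure on G: W maps onto G
   (so that A generates G as a monoid) and, for each x in A or x = 1, coded
   as Some a or None, MX x recognizes the pairs (w1, w2) of words of W such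
   that w1 x = w2 in G. *)
Definition automatic_axioms (G : groupType) (A : finType) (pi : A -> G)
    (W : seq A -> Prop) (MX : option A -> seq A -> seq A -> Prop) : Prop :=
  let ev (w : seq A) : G := \prod_(a <- w) pi a in
  (forall g : G, exists2 w, W w & ev w = g) /\
  (forall (x : option A) (w1 w2 : seq A),
     MX x w1 w2 <-> [/\ W w1, W w2 & ev w1 * oapp pi 1 x = ev w2]).

Definition automatic (G : groupType) : Prop :=
  exists (A : finType) (pi : A -> G) (W : dfa A)
    (MX : option A -> dfa (option A * option A)),
    automatic_axioms pi (dfa_lang W)
      (fun x w1 w2 => dfa_lang (MX x) (pad w1 w2)).

Definition asynchronously_automatic (G : groupType) : Prop :=
  exists (A : finType) (pi : A -> G) (W : dfa A)
    (MX : option A -> async_dfa A),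
    automatic_axioms pi (dfa_lang W) (fun x => async_lang (MX x)).

(* Main.v *)
Require Import Defs.
From HB Require Import structures.
From mathcomp Require Import all_boot all_order all_algebra.
From mathcomp Require Import boolp reals.
From mathcomp Require Import zify.

(* The finitely many generators q_1, ..., q_m of phi(G) give a chain
   N = N_0 < N_1 < ... < N_m = G with N_i the preimage of <q_1, ..., q_i>, and
   each N_i / N_(i-1) is cyclic, generated by some t_i.  A diagram over N_i is
   pushed down to N_(i-1) by conjugating the part lying over t_i^a by t_i^a.  As
   conjugation by t_i acts on a finite presentation of N_(i-1) through
   substitutions, a relator at exponent a becomes a diagram of area at most
   K^|a|; as Q is abelian, conjugation does not change the image in Q, so the
   heights (the images in Q) of the pushed diagram grow only linearly.  Hence a
   loop of N that bounds in G a diagram of area k and heights at most rho has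
   area at most k K^rho in N.

   In an automatic group G, a loop of length n is filled by strips between
   representatives W_0, ..., W_n of its successive vertices.  In each strip the
   two words stay at bounded distance, asynchronously, because their difference
   depends only on the state of a finite automaton; cutting the loops in the
   runs of the automaton gives |W_(i+1)| <= K (|W_i| + 1).  So the area is at
   most exponential in n, while the heights increase by a bounded amount from
   W_i to W_(i+1) and are thus linear in n. *)

Set Implicit Arguments.
Unset Strict Implicit.
Unset Printing Implicit Defensive.

Import GRing.Theory Num.Theory.

(** * Words, their values in groups, and substitutions *)

Section WordEval.
Local Open Scope group_scope.
Variables (X : Type) (H : groupType) (f : X -> H).

Lemma word_eval_nil : word_eval f [::] = 1.
Proof. by rewrite /word_eval big_nil. Qed.

Lemma word_eval_cons l w :
  word_eval f (l :: w) = (if l.2 then (f l.1)^-1 else f l.1) * word_eval f w.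
Proof. by rewrite /word_eval big_cons. Qed.

Lemma word_eval_cat u v : word_eval f (u ++ v) = word_eval f u * word_eval f v.
Proof. by rewrite /word_eval big_cat. Qed.

Lemma word_inv_cons l (w : word X) :
  word_inv (l :: w) = word_inv w ++ [:: letter_inv l].
Proof. by rewrite /word_inv /= rev_cons cats1. Qed.

Lemma word_inv_cat (u v : word X) : word_inv (u ++ v) = word_inv v ++ word_inv u.
Proof. by rewrite /word_inv map_cat rev_cat. Qed.

Lemma letter_invK : involutive (@letter_inv X).
Proof. by case=> x b; rewrite /letter_inv /= negbK. Qed.

Lemma word_invK : involutive (@word_inv X).
Proof. by move=> w; rewrite /word_inv map_rev revK (mapK letter_invK). Qed.

Lemma word_eval_inv w : word_eval f (word_inv w) = (word_eval f w)^-1.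
Proof.
elim: w => [|l w IH]; first by rewrite /word_inv word_eval_nil invg1.
rewrite word_inv_cons word_eval_cat IH !word_eval_cons word_eval_nil mulg1.
by rewrite invgM; case: l => x [] //=; rewrite invgK.
Qed.

Lemma word_eval_free u v : free_eq u v -> word_eval f u = word_eval f v.
Proof.
elim=> // [? ? ? _ -> _ -> //|{}u {}v [x b]].
rewrite !word_eval_cat; congr (_ * _).
rewrite !word_eval_cons word_eval_nil mulg1 /=.
by case: b; rewrite ?mulgV ?mulVg mul1g.
Qed.

End WordEval.

Lemma word_eval_morph (X : Type) (H K : groupType) (f : X -> H) (g : H -> K) :
  {morph g : x y / (x * y)%g} ->
  forall w, g (word_eval f w) = word_eval (g \o f) w.
Proof.
move=> gM; have g1 : g 1%g = 1%g by apply: (mulgI (g 1%g)); rewrite -gM !mulg1.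
have gV x : g x^-1%g = (g x)^-1%g.
  by apply: (mulgI (g x)); rewrite -gM !mulgV.
elim=> [|[x b] w IH]; first by rewrite !word_eval_nil.
by rewrite !word_eval_cons gM IH; case: b => /=; rewrite ?gV.
Qed.

(** The homomorphism of free groups that extends s, computed letter by letter without reduction. *)
Definition word_subst (X Y : Type) (s : X -> word Y) (w : word X) : word Y :=
  flatten [seq if l.2 then word_inv (s l.1) else s l.1 | l <- w].

Section Subst.
Variables (X Y : Type) (s : X -> word Y).

Lemma word_subst_cons l w :
  word_subst s (l :: w) =
  (if l.2 then word_inv (s l.1) else s l.1) ++ word_subst s w.
Proof. by []. Qed.

Lemma word_subst_cat u v :
  word_subst s (u ++ v) = word_subst s u ++ word_subst s v.
Proof. by rewrite /word_subst map_cat flatten_cat. Qed.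

Lemma word_subst_inv w : word_subst s (word_inv w) = word_inv (word_subst s w).
Proof.
elim: w => [|[x b] w IH] //; rewrite word_inv_cons word_subst_cat IH.
rewrite word_subst_cons word_inv_cat; congr (_ ++ _).
by rewrite /word_subst /= cats0; case: b => //=; rewrite word_invK.
Qed.

Lemma word_eval_subst (H : groupType) (f : Y -> H) w :
  word_eval f (word_subst s w) = word_eval (word_eval f \o s) w.
Proof.
elim: w => [|[x b] w IH]; first by rewrite /word_subst !word_eval_nil.
rewrite word_subst_cons word_eval_cat IH word_eval_cons /=.
by case: b => //=; rewrite word_eval_inv.
Qed.

End Subst.

Definition word_map (X Y : Type) (g : X -> Y) : word X -> word Y :=
  map (fun l => (g l.1, l.2)).

Lemma word_map_inv (X Y : Type) (g : X -> Y) w :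
  word_map g (word_inv w) = word_inv (word_map g w).
Proof.
by rewrite /word_map /word_inv map_rev -!map_comp; congr rev; apply: eq_map => l.
Qed.

Lemma word_eval_map (X Y : Type) (g : X -> Y) (H : groupType) (f : Y -> H) w :
  word_eval f (word_map g w) = word_eval (f \o g) w.
Proof. by rewrite /word_eval big_map. Qed.

(** * The group defined by a presentation *)

Section PresentedGroup.
Local Open Scope quotient_scope.
Variables (X : choiceType) (R : seq (word X)).

(** The congruence whose quotient is the group presented by R; for empty R it is equality in the
    free group. It counts no relators: areas are tracked by [fill]. *)
Inductive rel_eq : word X -> word X -> Prop :=
| rel_eq_refl w : rel_eq w w
| rel_eq_sym u v : rel_eq u v -> rel_eq v u
| rel_eq_trans u v w : rel_eq u v -> rel_eq v w -> rel_eq u w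
| rel_eq_cancel u v l : rel_eq (u ++ [:: l; letter_inv l] ++ v) (u ++ v)
| rel_eq_relator u v r : r \in R -> rel_eq (u ++ r ++ v) (u ++ v).

Definition rel_eqb u v : bool := `[< rel_eq u v >].

Lemma rel_eqb_equiv : equiv_class_of rel_eqb.
Proof.
split=> [u|u v|v u w].
- by apply/asboolP; apply: rel_eq_refl.
- by apply/asboolP/asboolP; apply: rel_eq_sym.
- by move=> /asboolP uv /asboolP vw; apply/asboolP; apply: rel_eq_trans vw.
Qed.

Canonical rel_eqb_equivRel := EquivRelPack rel_eqb_equiv.

Definition pgroup := {eq_quot rel_eqb}.
HB.instance Definition _ := Choice.on pgroup.

Definition pclass (w : word X) : pgroup := \pi_pgroup w.

Lemma pclassP u v : pclass u = pclass v <-> rel_eq u v.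
Proof.
split=> [/eqmodP/asboolP //|uv].
by apply/eqmodP/asboolP.
Qed.

Lemma rel_eq_cat u u' v v' :
  rel_eq u u' -> rel_eq v v' -> rel_eq (u ++ v) (u' ++ v').
Proof.
have cl w : rel_eq u u' -> rel_eq (u ++ w) (u' ++ w).
  elim=> [a|a b _|a b c _ ab _|a b l|a b r].
  - exact: rel_eq_refl.
  - exact: rel_eq_sym.
  - exact: rel_eq_trans.
  - by rewrite -!catA; apply: rel_eq_cancel.
  - by move=> rR; rewrite -!catA; apply: rel_eq_relator.
have cr w : rel_eq v v' -> rel_eq (w ++ v) (w ++ v').
  elim=> [a|a b _|a b c _ ab _|a b l|a b r].
  - exact: rel_eq_refl.
  - exact: rel_eq_sym.
  - exact: rel_eq_trans.
  - by rewrite !(catA w); apply: rel_eq_cancel.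
  - by move=> rR; rewrite !(catA w); apply: rel_eq_relator.
by move=> uu vv; apply: rel_eq_trans (cl _ uu) (cr _ vv).
Qed.

Lemma rel_eq_mulV w : rel_eq (w ++ word_inv w) [::].
Proof.
elim: w => [|l w IH]; first exact: rel_eq_refl.
rewrite word_inv_cons -[l :: w]cat1s -catA (catA w).
apply: rel_eq_trans (rel_eq_cancel [::] [::] l).
apply: rel_eq_cat (rel_eq_refl [:: l]) _.
exact: (rel_eq_cat IH (rel_eq_refl [:: letter_inv l])).
Qed.

Lemma rel_eq_inv u v : rel_eq u v -> rel_eq (word_inv u) (word_inv v).
Proof.
move=> uv; apply: rel_eq_trans (_ : rel_eq (word_inv u ++ (v ++ word_inv v)) _).
  apply: rel_eq_sym; rewrite -[X in rel_eq _ X]cats0.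
  by apply: rel_eq_cat (rel_eq_refl _) (rel_eq_mulV _).
rewrite catA -[X in rel_eq _ X]cat0s; apply: rel_eq_cat (rel_eq_refl _).
apply: rel_eq_trans (rel_eq_cat (rel_eq_refl _) (rel_eq_sym uv)) _.
by rewrite -{2}(word_invK u); apply: rel_eq_mulV.
Qed.

Definition pmul (x y : pgroup) : pgroup := pclass (repr x ++ repr y).
Definition pinv (x : pgroup) : pgroup := pclass (word_inv (repr x)).

Lemma rel_eq_repr w : rel_eq (repr (pclass w)) w.
Proof. by apply/pclassP; rewrite {1}/pclass reprK. Qed.

Lemma pmulE u v : pmul (pclass u) (pclass v) = pclass (u ++ v).
Proof. by apply/pclassP; apply: rel_eq_cat; apply: rel_eq_repr. Qed.

Lemma pinvE u : pinv (pclass u) = pclass (word_inv u).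
Proof. by apply/pclassP; apply: rel_eq_inv; apply: rel_eq_repr. Qed.

Lemma pclass_repr x : pclass (repr x) = x.
Proof. exact: reprK. Qed.

Lemma pmulA : associative pmul.
Proof.
move=> x y z; rewrite -(pclass_repr x) -(pclass_repr y) -(pclass_repr z).
by rewrite !pmulE catA.
Qed.

Lemma pmul1 : left_id (pclass [::]) pmul.
Proof. by move=> x; rewrite -(pclass_repr x) pmulE. Qed.

Lemma pmulr1 : right_id (pclass [::]) pmul.
Proof. by move=> x; rewrite -(pclass_repr x) pmulE cats0. Qed.

Lemma pmulV : left_inverse (pclass [::]) pinv pmul.
Proof.
move=> x; rewrite -(pclass_repr x) pinvE pmulE; apply/pclassP.
by rewrite -{2}(word_invK (repr x)); apply: rel_eq_mulV.
Qed.

Lemma pmulrV : right_inverse (pclass [::]) pinv pmul.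
Proof.
move=> x; rewrite -(pclass_repr x) pinvE pmulE; apply/pclassP.
exact: rel_eq_mulV.
Qed.

HB.instance Definition _ :=
  isGroup.Build pgroup pmulA pmul1 pmulr1 pmulV pmulrV.

Local Open Scope group_scope.

Lemma pclass_nil : pclass [::] = 1. Proof. by []. Qed.

Lemma pclass_cat u v : pclass (u ++ v) = pclass u * pclass v.
Proof. by rewrite -pmulE. Qed.

Lemma pclass_inv u : pclass (word_inv u) = (pclass u)^-1.
Proof. by rewrite -pinvE. Qed.

Lemma pclass_relator r : r \in R -> pclass r = 1.
Proof.
by move=> rR; apply/pclassP; have := rel_eq_relator [::] [::] rR; rewrite cats0.
Qed.

Lemma pclass_eval w : pclass w = word_eval (fun x => pclass [:: (x, false)]) w.
Proof.
elim: w => [|[x b] w IH]; first by rewrite word_eval_nil.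
rewrite word_eval_cons -IH -cat1s pclass_cat; congr (_ * _).
by case: b => //=; rewrite -pclass_inv.
Qed.

End PresentedGroup.

(** For empty R the classes form the free group, so free equalities can be proved by calculating in
    a group. *)
Lemma free_eqP (X : choiceType) (u v : word X) :
  pclass [::] u = pclass [::] v -> free_eq u v.
Proof.
move/pclassP; elim=> [w|a b _|a b c _ ab _|a b l|a b r] //.
- exact: free_eq_refl.
- exact: free_eq_sym.
- exact: free_eq_trans.
- exact: free_eq_cancel.
Qed.

Lemma pclass_free (X : choiceType) R (u v : word X) :
  free_eq u v -> pclass R u = pclass R v.
Proof. by rewrite !(pclass_eval R); apply: word_eval_free. Qed.

(** Turns the class of a word into a product of classes and cancels; this settles most free
    identities below. *)
Ltac word_group := rewrite ?(pclass_cat, pclass_inv, pclass_nil, invgM, invgK,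
  mulgA, invg1, mulg1, mul1g, mulgK, mulgVK, mulgV, mulVg).

(** Makes constants independent of the letter, relator or state: finitely many bounds that may be
    enlarged have a common one. *)
Lemma uniform_bound (I : finType) (P : I -> nat -> Prop) :
  (forall i m n, m <= n -> P i m -> P i n) ->
  (forall i, exists n, P i n) -> exists n, forall i, P i n.
Proof.
move=> Pmono /boolp.choice[F FP]; exists (\max_i F i) => i.
by apply: Pmono (FP i); apply: leq_bigmax.
Qed.

Lemma uniform_bound_seq (T : eqType) (s : seq T) (P : T -> nat -> Prop) :
  (forall i m n, m <= n -> P i m -> P i n) ->
  (forall i, i \in s -> exists n, P i n) ->
  exists n, forall i, i \in s -> P i n.
Proof.
move=> Pmono; elim: s => [|x s IH] Ps; first by exists 0.
have [n nP] := IH (fun i si => Ps i (mem_behead (s := x :: s) si)).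
have [m mP] := Ps x (mem_head _ _).
exists (maxn m n) => i; rewrite inE => /orP[/eqP->|/nP].
  by apply: Pmono mP; apply: leq_maxl.
by apply: Pmono; apply: leq_maxr.
Qed.

(** * Fillings with controlled heights *)

Section Ball.
Local Open Scope ring_scope.
Variable V : zmodType.
Implicit Types (qs : seq V) (u v : V).

(** The combinations of the entries of qs whose integer coefficients have absolute value at most n.
    The recursion lets a cyclic step split off one coefficient. *)
Fixpoint ball qs n v : Prop :=
  if qs is c :: qs' then exists2 a : int, (`|a| <= n)%N & ball qs' n (v - c *~ a)
  else v = 0.

Definition span qs v := exists n, ball qs n v.

Lemma ball_mono qs m n v : (m <= n)%N -> ball qs m v -> ball qs n v.
Proof.
move=> mn; elim: qs v => //= c qs IH v [a am /IH bv].
by exists a => //; apply: leq_trans mn.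
Qed.

Lemma ball0 qs n : ball qs n 0.
Proof. by elim: qs => //= c qs IH; exists 0 => //; rewrite mulr0z subr0. Qed.

Lemma ballD qs m n u v : ball qs m u -> ball qs n v -> ball qs (m + n) (u + v).
Proof.
elim: qs u v => [|c qs IH] u v /=; first by move=> -> ->; rewrite addr0.
move=> [a am bu] [b bn bv]; exists (a + b); first by lia.
by rewrite mulrzDr opprD addrACA; apply: IH.
Qed.

Lemma ballN qs n v : ball qs n v -> ball qs n (- v).
Proof.
elim: qs v => [|c qs IH] v /=; first by move=> ->; rewrite oppr0.
move=> [a an bv]; exists (- a); first by lia.
by rewrite mulrNz opprK -[c *~ a]opprK -opprD; apply: IH.
Qed.

Lemma ballMz qs n v (a : int) : ball qs n v -> ball qs (n * `|a|) (v *~ a).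
Proof.
move=> bv; have nat_case k : ball qs (n * k) (v *+ k).
  elim: k => [|k IH]; first by rewrite mulr0n; apply: ball0.
  by rewrite mulrS mulnS; apply: ballD.
case: a => k; first exact: nat_case.
by rewrite NegzE mulrNz; apply/ballN/nat_case.
Qed.

Lemma span0 qs : span qs 0. Proof. by exists 0%N; apply: ball0. Qed.

Lemma spanD qs u v : span qs u -> span qs v -> span qs (u + v).
Proof. by move=> [m bu] [n bv]; exists (m + n)%N; apply: ballD. Qed.

Lemma spanN qs v : span qs v -> span qs (- v).
Proof. by move=> [n bv]; exists n; apply: ballN. Qed.

Lemma spanB qs u v : span qs u -> span qs v -> span qs (u - v).
Proof. by move=> su sv; apply/spanD/spanN. Qed.

Lemma spanMz qs v (a : int) : span qs v -> span qs (v *~ a).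
Proof. by move=> [n bv]; exists (n * `|a|)%N; apply: ballMz. Qed.

Lemma span_consP c qs v :
  span (c :: qs) v <-> exists a : int, span qs (v - c *~ a).
Proof.
split=> [[n /= [a _ bv]]|[a [n bv]]]; first by exists a, n.
exists (maxn n `|a|); exists a; first exact: leq_maxr.
by apply: ball_mono bv; apply: leq_maxl.
Qed.

Lemma span_mem qs v : v \in qs -> span qs v.
Proof.
elim: qs => // c qs IH; rewrite inE => /orP[/eqP->|/IH sv]; apply/span_consP.
  by exists 1; rewrite mulr1z subrr; apply: span0.
by exists 0; rewrite mulr0z subr0.
Qed.

End Ball.

Section Fill.
Local Open Scope ring_scope.
Variables (G : groupType) (V : zmodType) (h : G -> V).
Hypothesis hM : forall x y, h (x * y)%g = h x + h y.

Lemma hom1 : h 1%g = 0.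
Proof. by apply: (addrI (h 1%g)); rewrite -hM mulg1 addr0. Qed.

Lemma homV x : h x^-1%g = - h x.
Proof. by apply: (addrI (h x)); rewrite -hM mulgV hom1 subrr. Qed.

Definition height (X : Type) (f : X -> G) w := h (word_eval f w).

Variables (X : choiceType) (R : seq (word X)) (f : X -> G).

(* [fill Adm q k w]: the loop w, read from a base point at height q, bounds a
   diagram of at most k relators, each attached at a height satisfying Adm. *)
Inductive fill (Adm : V -> Prop) : V -> nat -> word X -> Prop :=
| fill_nil q : fill Adm q 0 [::]
| fill_relator q r : r \in R -> Adm q -> fill Adm q 1 r
| fill_inv q k w : fill Adm q k w -> fill Adm q k (word_inv w)
| fill_cat q k1 k2 w1 w2 :
    fill Adm q k1 w1 -> fill Adm q k2 w2 -> fill Adm q (k1 + k2) (w1 ++ w2)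
| fill_conj q k u w :
    fill Adm (q + height f u) k w -> fill Adm q k (u ++ w ++ word_inv u)
| fill_free q k w w' : free_eq w w' -> fill Adm q k w -> fill Adm q k w'
| fill_weaken q k k' w : (k <= k')%N -> fill Adm q k w -> fill Adm q k' w.

Lemma fill_mono (Adm Adm' : V -> Prop) q k k' w :
  (forall v, Adm v -> Adm' v) -> (k <= k')%N -> fill Adm q k w -> fill Adm' q k' w.
Proof.
move=> sub kk' F; apply: fill_weaken kk' _; elim: F => {q k k' w}.
- by move=> q; apply: fill_nil.
- by move=> q r rR Aq; apply: fill_relator => //; apply: sub.
- by move=> q k w _; apply: fill_inv.
- by move=> q k1 k2 w1 w2 _ IH1 _ IH2; apply: fill_cat.
- by move=> q k u w _; apply: fill_conj.
- by move=> q k w w' ww' _; apply: fill_free.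
- by move=> q k k' w kk' _; apply: fill_weaken.
Qed.

Lemma fill_class Adm q k w w' :
  pclass [::] w = pclass [::] w' -> fill Adm q k w -> fill Adm q k w'.
Proof. by move=> /free_eqP; apply: fill_free. Qed.

Lemma fill_trivial Adm q k w : pclass [::] w = 1%g -> fill Adm q k w.
Proof.
by move=> w1; apply: fill_weaken (leq0n k) _; apply: fill_class (fill_nil _ _).
Qed.

Lemma heightN u : height f (word_inv u) = - height f u.
Proof. by rewrite /height word_eval_inv homV. Qed.

Lemma fill_eval Adm q k w :
  (forall r, r \in R -> word_eval f r = 1%g) ->
  fill Adm q k w -> word_eval f w = 1%g.
Proof.
move=> R1; elim=> {q k w}.
- by move=> _; rewrite word_eval_nil.
- by move=> _ r rR _; apply: R1.
- by move=> _ _ w _ ew; rewrite word_eval_inv ew invg1.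
- by move=> _ _ _ w1 w2 _ e1 _ e2; rewrite word_eval_cat e1 e2 mulg1.
- move=> _ _ u w _ ew.
  by rewrite !word_eval_cat ew mul1g word_eval_inv mulgV.
- by move=> _ _ w w' ww' _ <-; rewrite (word_eval_free f ww').
- by [].
Qed.

Variable qs : seq V.
Hypothesis f_span : forall w, span qs (height f w).

(** One fixed derivation of w is carried to every base point: it uses a fixed number of relators,
    each at a fixed displacement from p, so K depends on w only. *)
Lemma fill_relation w : pclass R w = 1%g ->
  exists K, forall p rho, ball qs rho p -> fill (ball qs (rho + K)) p K w.
Proof.
rewrite -pclass_nil => /pclassP.
(* A derivation passes through arbitrary pairs of words, so the induction fills u v^-1 for each
   pair. *)
suff: forall u v, rel_eq R u v -> exists K, forall p rho, ball qs rho p ->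
    fill (ball qs (rho + K)) p K (u ++ word_inv v).
  by move=> S /S; rewrite cats0.
move=> u v; elim=> {u v w}.
- by move=> w; exists 0%N => p rho _; apply: fill_trivial; word_group.
- move=> u v _ [K KP]; exists K => p rho /KP/fill_inv.
  by apply: fill_class; word_group.
- move=> u v w _ [K KP] _ [L LP]; exists (K + L)%N => p rho bp.
  apply: (@fill_class _ _ _ ((u ++ word_inv v) ++ (v ++ word_inv w))).
    by word_group.
  apply: fill_cat; [move: (KP _ _ bp)|move: (LP _ _ bp)]; apply: fill_mono => //.
    by move=> x; apply: ball_mono; lia.
  by move=> x; apply: ball_mono; lia.
- move=> u v l; exists 0%N => p rho _; apply: fill_trivial.
  rewrite !pclass_cat (_ : pclass _ [:: l; _] = 1%g) ?mul1g; last first.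
    by apply/pclassP; apply: (rel_eq_cancel [::] [::] [::] l).
  by word_group.
- move=> u v r rR; have [K KP] := f_span u; exists K.+1 => p rho bp.
  apply: (@fill_class _ _ _ (u ++ r ++ word_inv u)); first by word_group.
  apply: fill_conj; apply: (@fill_weaken _ _ 1) => //; apply: fill_relator => //.
  by apply: ball_mono (ballD bp KP); lia.
Qed.

End Fill.

(** * Pushing fillings down a cyclic extension *)

Section IntegerPower.
Local Open Scope group_scope.
Variable H : groupType.
Implicit Types (x : H) (a b : int).

Definition zpow x a := match a with Posz n => x ^+ n | Negz n => x ^- n.+1 end.

Lemma zpowS x a : zpow x (a + 1)%R = zpow x a * x.
Proof.
case: a => [n|[|n]]; first by rewrite -PoszD addn1 /= expgSr.
  by rewrite /= mulVg.
rewrite (_ : (Negz n.+1 + 1)%R = Negz n); last by lia.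
by rewrite /= [in RHS]expgS invgM mulgVK.
Qed.

Lemma zpowB1 x a : zpow x (a - 1)%R = zpow x a * x^-1.
Proof. by rewrite -{2}(subrK 1%R a) zpowS mulgK. Qed.

Lemma zpowD x a b : zpow x (a + b)%R = zpow x a * zpow x b.
Proof.
elim/int_rect: b => [|n IH|n IH]; first by rewrite addr0 mulg1.
  by rewrite intS (addrC 1%R) addrA !zpowS IH mulgA.
by rewrite intS opprD (addrC (- 1)%R) addrA !zpowB1 IH mulgA.
Qed.

Lemma zpowN x a : zpow x (- a)%R = (zpow x a)^-1.
Proof. by apply: (mulgI (zpow x a)); rewrite -zpowD subrr mulgV. Qed.

End IntegerPower.

Lemma eq_word_eval (X : Type) (H : groupType) (f g : X -> H) w :
  f =1 g -> word_eval f w = word_eval g w.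
Proof.
by move=> fg; rewrite /word_eval; apply: eq_bigr => l _; rewrite fg.
Qed.

Lemma word_eval_pclass (X Y : choiceType) (R : seq (word Y)) (s : X -> word Y) w :
  pclass R (word_subst s w) = word_eval (pclass R \o s) w.
Proof.
rewrite pclass_eval word_eval_subst; apply: eq_word_eval => x /=.
by rewrite pclass_eval.
Qed.

Lemma rel_eq_map (X Y : choiceType) (R : seq (word X)) (S : seq (word Y)) j :
  {subset map (word_map j) R <= S} ->
  forall u v, rel_eq R u v -> rel_eq S (word_map j u) (word_map j v).
Proof.
move=> RS u v; elim=> {u v}.
- by move=> w; apply: rel_eq_refl.
- by move=> u v _; apply: rel_eq_sym.
- by move=> u v w _ uv _; apply: rel_eq_trans uv.
- by move=> u v l; rewrite /word_map !map_cat; apply: rel_eq_cancel.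
- move=> u v r rR; rewrite /word_map !map_cat; apply: rel_eq_relator.
  by apply: RS; apply: map_f.
Qed.

(** A subgroup of G is given by a predicate, so that all stages of the tower live in the same G. *)
Definition presents (G : groupType) (H : G -> Prop) (X : choiceType)
    (R : seq (word X)) (f : X -> G) : Prop :=
  [/\ forall w, H (word_eval f w),
      forall x, H x -> exists w, word_eval f w = x,
      forall r, r \in R -> word_eval f r = 1%g
    & forall w, word_eval f w = 1%g -> pclass R w = 1%g].

Lemma presents_eq (G : groupType) H X R f u v : @presents G H X R f ->
  word_eval f u = word_eval f v -> pclass R u = pclass R v.
Proof.
move=> [_ _ _ pres] uv; apply: (mulIg (pclass R v)^-1%g).
by rewrite mulgV -pclass_inv -pclass_cat pres // word_eval_cat word_eval_inv uv mulgV.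
Qed.

(** * Rewriting over a cyclic quotient with representatives t^a *)

Section CyclicStep.
Local Open Scope ring_scope.
Variables (G : groupType) (V : zmodType) (h : G -> V).
Hypothesis hM : forall x y, h (x * y)%g = h x + h y.
Variables (qs : seq V) (t : G).
Local Notation c := (h t).
Variables (Y : finType) (S : seq (word Y)) (g : Y -> G).
Hypothesis g_presents : presents (fun x => span qs (h x)) S g.
Variables (thp thm : Y -> word Y).
Hypothesis thpE : forall y, word_eval g (thp y) = (t * g y * t^-1)%g.
Hypothesis thmE : forall y, word_eval g (thm y) = (t^-1 * g y * t)%g.
(* The quotient of the subgroup {h x \in <c, qs>} by {h x \in <qs>} is
   Z/dZ, which is infinite cyclic when d = 0, and a %% 0 = a. *)
Variable d : nat.
Hypothesis d_span : span qs (c *~ d).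
Hypothesis d_dvd : forall n : int, span qs (c *~ n) -> (d %| n)%Z.
Definition reduced (a : int) := (a %% d)%Z = a.
(** The carry: when t^a t is brought back to a reduced exponent, [e a] is the factor that is left in
    the smaller subgroup. *)
Variable e : int -> word Y.
Hypothesis e_eval : forall a : int,
  word_eval g (e a) = zpow t (a + 1 - ((a + 1) %% d)%Z).
Hypothesis e_nil : d = 0%N -> forall a, e a = [::].

(** A word for t^a w t^-a. The substitutions [thp] and [thm] are mutually inverse only modulo the
    relations of S, so the two signs of a are treated apart. *)
Definition twist (a : int) (w : word Y) : word Y :=
  match a with
  | Posz n => iter n (word_subst thp) w
  | Negz n => iter n.+1 (word_subst thm) w
  end.

(** Reidemeister-Schreier rewriting: a letter l read at the coset of t^a satisfies t^a l =
    [push1 a l] t^b with b = [move1 a l]. *)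
Definition push1 (a : int) (l : option Y * bool) : word Y :=
  match l with
  | (Some y, b) => twist a [:: (y, b)]
  | (None, false) => e a
  | (None, true) => word_inv (e ((a - 1) %% d)%Z)
  end.

Definition move1 (a : int) (l : option Y * bool) : int :=
  match l with
  | (Some _, _) => a
  | (None, false) => ((a + 1) %% d)%Z
  | (None, true) => ((a - 1) %% d)%Z
  end.

Fixpoint push (a : int) (w : word (option Y)) : word Y :=
  if w is l :: w' then push1 a l ++ push (move1 a l) w' else [::].

Fixpoint move (a : int) (w : word (option Y)) : int :=
  if w is l :: w' then move (move1 a l) w' else a.

Definition step_val : option Y -> G := oapp g t.

Definition conj_relator (y : Y) : word (option Y) :=
  [:: (None, false); (Some y, false); (None, true)]
    ++ word_inv (word_map Some (thp y)).

(** The relation t^(i+1) = [e i] t^((i+1) mod d). For i + 1 < d it makes [e i] trivial, and for i +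
    1 = d it expresses t^d in the smaller subgroup. *)
Definition wrap_relator (i : nat) : word (option Y) :=
  nseq i.+1 (None, false) ++
  word_inv (word_map Some (e i) ++ nseq (i.+1 %% d)%N (None, false)).

Definition step_relators : seq (word (option Y)) :=
  map (word_map Some) S ++ map conj_relator (enum Y) ++ map wrap_relator (iota 0 d).

Lemma reduced_mod a : reduced (a %% d)%Z. Proof. exact: modz_mod. Qed.

Lemma reduced_move1 a l : reduced a -> reduced (move1 a l).
Proof. by case: l => [[y|] []] //= _; apply: reduced_mod. Qed.

Lemma reduced_move a w : reduced a -> reduced (move a w).
Proof. by elim: w a => //= l w IH a ra; apply/IH/reduced_move1. Qed.

Lemma reduced0 : reduced 0. Proof. exact: mod0z. Qed.

Lemma moveK a : reduced a -> ((((a - 1) %% d)%Z + 1) %% d)%Z = a.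
Proof. by move=> ra; rewrite modzDml subrK. Qed.

Lemma moveKV a : reduced a -> ((((a + 1) %% d)%Z - 1) %% d)%Z = a.
Proof. by move=> ra; rewrite modzDml addrK. Qed.

Lemma push_cat a u v : push a (u ++ v) = push a u ++ push (move a u) v.
Proof. by elim: u a => //= l u IH a; rewrite IH catA. Qed.

Lemma move_cat a u v : move a (u ++ v) = move (move a u) v.
Proof. by elim: u a => //=. Qed.

Lemma twist_cat a u v : twist a (u ++ v) = twist a u ++ twist a v.
Proof.
by case: a => n /=; elim: n => [|n IH] //=; rewrite ?IH ?word_subst_cat.
Qed.

Lemma twist_inv a u : twist a (word_inv u) = word_inv (twist a u).
Proof.
by case: a => n /=; elim: n => [|n IH] //=; rewrite ?IH ?word_subst_inv.
Qed.

Lemma push_map a u : push a (word_map Some u) = twist a u.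
Proof.
elim: u => [|[y b] u IH] /=; first by case: a => n /=; elim: n => //= n <-.
by rewrite IH -twist_cat.
Qed.

(** A letter followed by its inverse leads back to the same exponent and is pushed to a freely
    trivial word. *)
Lemma push_free a u v : reduced a -> free_eq u v ->
  pclass [::] (push a u) = pclass [::] (push a v) /\ move a u = move a v.
Proof.
move=> ra uv; elim: uv a ra => {u v}.
- by [].
- by move=> u v _ IH a /IH[-> ->].
- by move=> u v w _ IH1 _ IH2 a ra; have [-> ->] := IH1 _ ra; apply: IH2.
move=> u v l a ra; rewrite !push_cat !move_cat.
have rb := reduced_move u ra; move: (move a u) rb => b rb.
have -> : move b [:: l; letter_inv l] = b.
  by case: l => [[y|] []] //=; rewrite ?moveK ?moveKV.
split=> //; rewrite !(pclass_cat _ (push a u)) (pclass_cat _ (push b [:: _; _])).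
congr (_ * _)%g.
rewrite (_ : pclass _ (push b [:: _; _]) = 1%g) ?mul1g //.
case: l => [[y|] bb]; rewrite /letter_inv /= ?cats0; last first.
  by case: bb => /=; rewrite ?cats0 ?moveK ?moveKV //; word_group.
rewrite (_ : [:: (y, ~~ bb)] = word_inv [:: (y, bb)]) // twist_inv.
by word_group.
Qed.

Lemma push_inv a u : reduced a -> move a u = a ->
  pclass [::] (push a (word_inv u)) = (pclass [::] (push a u))^-1%g.
Proof.
move=> ra mu; apply: (mulgI (pclass [::] (push a u))); rewrite mulgV.
rewrite -pclass_cat -{2}mu -push_cat.
have [|-> _] // := @push_free a (u ++ word_inv u) [::] ra.
by apply: free_eqP; word_group.
Qed.

Lemma push_conj a u w : reduced a -> move (move a u) w = move a u ->
  pclass [::] (push a (u ++ w ++ word_inv u)) =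
  pclass [::] (push a u ++ push (move a u) w ++ word_inv (push a u)).
Proof.
move=> ra mw; rewrite !push_cat mw !pclass_cat; do 2!congr (_ * _)%g.
rewrite pclass_inv; apply: (mulgI (pclass [::] (push a u))); rewrite mulgV.
rewrite -pclass_cat -push_cat.
have [|-> _] // := @push_free a (u ++ word_inv u) [::] ra.
by apply: free_eqP; word_group.
Qed.

Section PushEval.
Local Open Scope group_scope.
Variables (H : groupType) (tau : H) (j : Y -> H).
Hypothesis j_p : forall y, word_eval j (thp y) = tau * j y * tau^-1.
Hypothesis j_m : forall y, word_eval j (thm y) = tau^-1 * j y * tau.
Hypothesis j_e : forall a, reduced a ->
  word_eval j (e a) = zpow tau (a + 1 - ((a + 1) %% d)%Z)%R.

Lemma subst_eval (x : H) (s : Y -> word Y) w :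
  (forall y, word_eval j (s y) = x * j y * x^-1) ->
  word_eval j (word_subst s w) = x * word_eval j w * x^-1.
Proof.
move=> js; rewrite word_eval_subst (@word_eval_morph _ _ _ _ (fun z => x * z * x^-1)).
  exact: eq_word_eval.
by move=> y z; rewrite !mulgA mulgVK.
Qed.

Lemma twist_eval a w :
  word_eval j (twist a w) = zpow tau a * word_eval j w * (zpow tau a)^-1.
Proof.
case: a => n /=.
  elim: n => [|n IH] /=; first by rewrite invg1 mulg1 mul1g.
  by rewrite (subst_eval (x := tau)) // IH expgS invgM !mulgA.
suff E m : word_eval j (iter m (word_subst thm) w) =
    tau ^- m * word_eval j w * (tau ^- m)^-1 by exact: (E n.+1).
elim: m => [|m IH] /=; first by rewrite !invg1 mulg1 mul1g.
rewrite (subst_eval (x := tau^-1)) ?IH => [|y]; last by rewrite j_m invgK.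
by rewrite expgSr !invgM !invgK !mulgA.
Qed.

(** Stated for any group in which the relations of tau and j hold, since it is applied both in G and
    in the group presented by [step_relators]. *)
Lemma push_eval a w : reduced a ->
  word_eval j (push a w) * zpow tau (move a w) =
  zpow tau a * word_eval (oapp j tau) w.
Proof.
elim: w a => [|l w IH] a ra /=; first by rewrite !word_eval_nil mul1g mulg1.
rewrite word_eval_cat -mulgA IH ?word_eval_cons; last exact: reduced_move1.
rewrite mulgA [in RHS]mulgA; congr (_ * _).
case: l => [[y|] b] /=.
  by rewrite twist_eval mulgVK word_eval_cons word_eval_nil mulg1.
case: b => /=; last by rewrite j_e // -zpowD subrK zpowS.
rewrite word_eval_inv j_e ?moveK //; last exact: reduced_mod.
rewrite -zpowN -zpowD -zpowB1; congr zpow.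
by move: (_ %% _)%Z => x; lia.
Qed.

End PushEval.

Lemma height_zpow a : h (zpow t a) = c *~ a.
Proof.
elim/int_rect: a => [|n IH|n IH]; first by rewrite mulr0z (hom1 hM).
  by rewrite intS addrC zpowS hM IH mulrzDr mulr1z.
by rewrite intS opprD addrC zpowB1 hM (homV hM) IH mulrzDr mulrN1z.
Qed.

Lemma push_val a w : reduced a ->
  (word_eval g (push a w) * zpow t (move a w) =
   zpow t a * word_eval step_val w)%g.
Proof. by apply: push_eval => // b _; apply: e_eval. Qed.

Lemma reduced_unique a b : reduced a -> reduced b ->
  span qs (c *~ (a - b)) -> a = b.
Proof.
move=> ra rb /d_dvd; rewrite -eqz_mod_dvd => /eqP.
by rewrite ra rb.
Qed.

(** As w is trivial, the powers of t at its two ends differ by an element of the smaller subgroup;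
    reduced exponents represent distinct cosets, so they agree and the pushed word is a loop. *)
Lemma push_null a w : reduced a -> word_eval step_val w = 1%g ->
  move a w = a /\ word_eval g (push a w) = 1%g.
Proof.
move=> ra w1; have := push_val w ra; rewrite w1 mulg1 => E.
have mE : move a w = a.
  apply/esym/reduced_unique => //; first exact: reduced_move.
  rewrite -height_zpow zpowD -E zpowN mulgK.
  by case: g_presents => gs _ _ _; apply: gs.
by split=> //; apply: (mulIg (zpow t a)); rewrite mul1g -{2}E mE.
Qed.

Lemma word_eval_nseq (X : Type) (H : groupType) (f : X -> H) n x :
  word_eval f (nseq n (x, false)) = (f x ^+ n)%g.
Proof.
elim: n => [|n IH]; first by rewrite word_eval_nil.
by rewrite word_eval_cons IH expgS.
Qed.

Lemma step_val_map w : word_eval step_val (word_map Some w) = word_eval g w.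
Proof. by rewrite word_eval_map. Qed.

Lemma step_relator_val r : r \in step_relators -> word_eval step_val r = 1%g.
Proof.
have [_ _ g_rel _] := g_presents.
rewrite !mem_cat => /or3P[/mapP[s sS ->]|/mapP[y _ ->]|/mapP[i _ ->]].
- by rewrite step_val_map g_rel.
- rewrite word_eval_cat word_eval_inv step_val_map thpE !word_eval_cons.
  by rewrite word_eval_nil /= mulg1 mulgA mulgV.
rewrite word_eval_cat word_eval_inv word_eval_cat !word_eval_nseq step_val_map.
rewrite e_eval; apply/eqP; rewrite divg_eq1 -/(zpow t i.+1); apply/eqP.
rewrite (_ : (t ^+ (i.+1 %% d)%N)%g = zpow t ((Posz i + 1) %% d)%Z); last first.
  by rewrite -PoszD addn1 modz_nat.
by rewrite -zpowD subrK -PoszD addn1.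
Qed.

Lemma height_step_val w : span (c :: qs) (h (word_eval step_val w)).
Proof.
have letter_span o : span (c :: qs) (h (step_val o)).
  case: o => [y|]; apply/span_consP; last first.
    by exists 1; rewrite mulr1z subrr; apply: span0.
  exists 0; rewrite mulr0z subr0.
  have [+ _ _ _] := g_presents => /(_ [:: (y, false)]).
  by rewrite word_eval_cons word_eval_nil mulg1.
elim: w => [|[o b] w IH]; first by rewrite word_eval_nil (hom1 hM); apply: span0.
rewrite word_eval_cons hM; apply: spanD => //; case: b => //=.
by rewrite (homV hM); apply: spanN.
Qed.

Lemma step_val_surj x : span (c :: qs) (h x) ->
  exists w, word_eval step_val w = x.
Proof.
move=> /span_consP[a xa]; have [_ gen _ _] := g_presents.
have /gen[w wE] : span qs (h (x * zpow t (- a)))%g.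
  by rewrite hM height_zpow mulrNz.
pose tw b := if b is Posz n then nseq n (None, false)
  else word_inv (nseq (absz b) (None : option Y, false)).
have twE b : word_eval step_val (tw b) = zpow t b.
  by case: b => n; rewrite /tw ?word_eval_inv word_eval_nseq.
exists (word_map Some w ++ tw a).
by rewrite word_eval_cat step_val_map wE twE -mulgA -zpowD addNr mulg1.
Qed.

Lemma reduced_nat a : d != 0%N -> reduced a -> exists2 i : nat, (i < d)%N & a = i.
Proof.
move=> d0 ra.
have := modz_ge0 a (d := d); have := ltz_mod a (d := d); rewrite ra.
by case: a ra => // i _ ? ?; exists i; lia.
Qed.

(** In the presented group a null word w equals its push from exponent 0. That push is null in G,
    hence a consequence of S, and the relators of S are among the new ones. *)
Lemma step_presents :
  presents (fun x => span (c :: qs) (h x)) step_relators step_val.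
Proof.
split; [exact: height_step_val|exact: step_val_surj|exact: step_relator_val|].
move=> w w1; set R := step_relators.
pose tau := pclass R [:: (None, false)]; pose j y := pclass R [:: (Some y, false)].
have jE u : word_eval j u = pclass R (word_map Some u).
  by rewrite [RHS]pclass_eval word_eval_map; apply: eq_word_eval.
have j_resp u v : pclass S u = pclass S v -> word_eval j u = word_eval j v.
  rewrite !jE => /pclassP uv; apply/pclassP; apply: rel_eq_map uv => r rS.
  by rewrite mem_cat rS.
have j_p y : (word_eval j (thp y) = tau * j y * tau^-1)%g.
  have : pclass R (conj_relator y) = 1%g.
    by apply: pclass_relator; rewrite !mem_cat (map_f conj_relator) ?mem_enum ?orbT.
  rewrite pclass_cat pclass_inv -jE => /divg1_eq <-.
  rewrite -[[:: _, _ & _]]/([:: (None, false)] ++ [:: (Some y, false)] ++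
    word_inv [:: (None, false)]).
  by rewrite !pclass_cat pclass_inv mulgA.
(* As [thp] applied to [thm y] equals y modulo S, the relation for [thm] follows from the one for
   [thp]. *)
have j_m y : (word_eval j (thm y) = tau^-1 * j y * tau)%g.
  have -> : j y = word_eval j (word_subst thp (thm y)).
    rewrite -[j y]mulg1 -(word_eval_nil j) -(word_eval_cons j (y, false)).
    apply/j_resp/(presents_eq g_presents).
    rewrite (subst_eval _ thpE) thmE word_eval_cons word_eval_nil mulg1.
    by rewrite !mulgA mulgV mul1g mulgK.
  by rewrite (subst_eval _ j_p) !mulgA mulVg mul1g mulgVK.
have j_e a : reduced a -> word_eval j (e a) = zpow tau (a + 1 - ((a + 1) %% d)%Z).
  have [d0 _|d0 ra] := eqVneq d 0%N.
    by rewrite e_nil // word_eval_nil d0 modz0 subrr.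
  have [i id ->] := reduced_nat d0 ra.
  have : pclass R (wrap_relator i) = 1%g.
    apply: pclass_relator; rewrite !mem_cat (map_f wrap_relator) ?orbT //.
    by rewrite mem_iota.
  have nseqE n : pclass R (nseq n (None, false)) = zpow tau n.
    by rewrite pclass_eval word_eval_nseq.
  rewrite pclass_cat pclass_inv pclass_cat -jE !nseqE => /divg1_eq.
  by move=> E; rewrite zpowD zpowN -PoszD addn1 modz_nat E mulgK.
have [m0 p1] := push_null reduced0 w1.
have /j_resp E : pclass S (push 0 w) = pclass S [::].
  by apply: (presents_eq g_presents); rewrite p1 word_eval_nil.
have := push_eval j_p j_m j_e w reduced0.
rewrite m0 E word_eval_nil !mul1g => W; rewrite pclass_eval [RHS]W.
by apply: eq_word_eval => -[].
Qed.

Local Notation filling rho := (fill h S g (ball qs rho)).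

Lemma height_g w : span qs (height h g w).
Proof. by have [gs _ _ _] := g_presents; apply: gs. Qed.

Lemma fill_null w : word_eval g w = 1%g ->
  exists K, forall p rho, ball qs rho p -> filling (rho + K) p K w.
Proof.
have [_ _ _ pres] := g_presents.
by move=> /pres/(fill_relation height_g).
Qed.

(** Conjugation by x sends each relator to a null word, which has a filling of bounded size. It
    preserves heights because V is abelian, so the base points of the pieces do not move. *)
Lemma fill_subst (x : G) (s : Y -> word Y) :
  (forall y, word_eval g (s y) = x * g y * x^-1)%g ->
  exists K, forall rho p k w, filling rho p k w ->
    filling (rho + K) p (K * k) (word_subst s w).
Proof.
move=> sE; have [_ _ g_rel _] := g_presents.
pose P r K := forall p rho, ball qs rho p -> filling (rho + K) p K (word_subst s r).
have [r m n mn Pm p rho bp|r rS|K KP] := @uniform_bound_seq _ S P.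
- by apply: fill_mono (Pm _ _ bp) => // v; apply: ball_mono; lia.
- by apply: fill_null; rewrite (subst_eval _ sE) g_rel // mulg1 mulgV.
exists K => rho p k w; elim=> {p k w}.
- by move=> p; apply: fill_trivial.
- by move=> p r rS bp; rewrite muln1; apply: KP.
- by move=> p k w _ IH; rewrite word_subst_inv; apply: fill_inv.
- by move=> p k l u v _ IHu _ IHv; rewrite mulnDr word_subst_cat; apply: fill_cat.
- move=> p k u w _ IH; rewrite !word_subst_cat word_subst_inv.
  apply: fill_conj; rewrite {1}/height (subst_eval _ sE) !hM (homV hM).
  by rewrite addrAC subrr add0r.
- move=> p k u v uv _; apply: fill_free.
  by apply: free_eqP; rewrite !word_eval_pclass; apply: word_eval_free.
- by move=> p k k' w kk' _; apply: fill_weaken; rewrite leq_mul2l kk' orbT.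
Qed.

(** Each of the |a| substitutions multiplies the area by a constant and adds a constant to the
    heights. *)
Lemma fill_twist : exists2 K, (0 < K)%N & forall a rho p k w,
  filling rho p k w -> filling (rho + K * `|a|) p (K ^ `|a| * k) (twist a w).
Proof.
have [K1 K1P] := fill_subst thpE.
have [|K2 K2P] := @fill_subst t^-1%g thm; first by move=> y; rewrite invgK.
exists (K1 + K2).+1 => // a rho p k w F.
suff iter_case s K n : (K <= K1 + K2)%N ->
    (forall rho p k w, filling rho p k w ->
      filling (rho + K) p (K * k) (word_subst s w)) ->
    filling (rho + (K1 + K2).+1 * n) p ((K1 + K2).+1 ^ n * k)
      (iter n (word_subst s) w).
  by case: a => n; [apply: (iter_case _ K1)|apply: (iter_case _ K2)] => //; lia.
move=> KK KP; elim: n => [|n IH]; first by rewrite muln0 addn0 mul1n.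
move: (KP _ _ _ _ IH); apply: fill_mono => [v|].
  by apply: ball_mono; rewrite mulnS; lia.
by rewrite expnS -mulnA leq_mul2r; apply/orP; right; lia.
Qed.

Lemma fill_twist_null z : word_eval g z = 1%g ->
  exists K, forall (a : int) p rho, ball qs rho p ->
    filling (rho + K * `|a|.+1) p (K ^ `|a|.+1) (twist a z).
Proof.
move=> z1; have [K K0 KP] := fill_twist; have [L LP] := fill_null z1.
exists (K + L)%N => a p rho bp; move: (KP a _ _ _ _ (LP _ _ bp)).
apply: fill_mono => [v|]; first by apply: ball_mono; nia.
rewrite [leqRHS]expnS mulnC; apply: leq_mul; first exact: leq_addl.
by elim: `|a|%N => // n IH; rewrite !expnS leq_mul ?leq_addr.
Qed.

(** If d > 0, only finitely many exponents are reduced and each gives a fixed null word. If d = 0,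
    relators of S are twisted, and a conjugation relator becomes freely trivial for a >= 0 and a
    twisted null word for a < 0. *)
Lemma fill_push_relator r : r \in step_relators ->
  exists K, forall (a : int) p rho, reduced a -> ball qs rho p ->
    filling (rho + K * `|a|.+1) p (K ^ `|a|.+1) (push a r).
Proof.
move=> rR; have [d0|d0] := eqVneq d 0%N; last first.
  pose P (i : 'I_d) K := forall p rho, ball qs rho p -> filling (rho + K) p K (push i r).
  have [i m n mn Pm p rho bp|i|K KP] := @uniform_bound _ P.
  - by apply: fill_mono (Pm _ _ bp) => // v; apply: ball_mono; lia.
  - apply: fill_null; apply: (proj2 (push_null _ _)); last exact: step_relator_val.
    by rewrite /reduced modz_nat modn_small.
  exists K.+1 => a p rho /(reduced_nat d0)[i id ->] bp.
  move: (KP (Ordinal id) _ _ bp); apply: fill_mono => [v|]; last first.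
    by rewrite expnS; apply: leq_trans (leq_pmulr _ _); rewrite ?expn_gt0.
  by apply: ball_mono => /=; nia.
have [_ _ g_rel _] := g_presents.
move: rR; rewrite !mem_cat => /or3P[/mapP[s sS ->]|/mapP[y _ ->]|/mapP[i]].
- have [K KP] := fill_twist_null (g_rel _ sS).
  by exists K => a p rho _ bp; rewrite push_map; apply: KP.
(* The relation y = [thm] of [thp y]. For a < 0 the pushed conjugation relator is z twisted by a +
   1, because one [thm] cancels against [thp] only modulo S. *)
- pose z := [:: (y, false)] ++ word_inv (word_subst thm (thp y)).
  have z1 : word_eval g z = 1%g.
    rewrite word_eval_cat word_eval_inv (@subst_eval _ g t^-1%g) => [|y']; last first.
      by rewrite invgK.
    by rewrite thpE invgK word_eval_cons word_eval_nil !mulgA mulVg !mulg1 mul1g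
      mulgVK mulgV.
  have [K KP] := fill_twist_null z1; exists K => a p rho ra bp.
  have pE : pclass [::] (push a (conj_relator y)) =
      pclass [::] (twist (a + 1) [:: (y, false)] ++ word_inv (twist a (thp y))).
    rewrite /conj_relator /= !(e_nil d0) /= d0 !modz0 -word_map_inv push_map.
    by rewrite addrK twist_inv.
  have [a0|a0] : (0 <= a) \/ (a < 0) by lia.
    apply: fill_trivial; rewrite pE; case: a a0 {ra pE} => // n _.
    rewrite -PoszD addn1 /twist iterSr /word_subst /= cats0.
    by word_group.
  have twE u : twist a (word_subst thp u) = twist (a + 1) (word_subst thm (word_subst thp u)).
    case: a a0 {ra pE} => // -[|n] _; first by [].
    by rewrite (_ : Negz n.+1 + 1 = Negz n); [apply: iterSr|lia].
  move: (KP (a + 1) _ _ bp); rewrite /z twist_cat.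
  have -> : thp y = word_subst thp [:: (y, false)] by rewrite /word_subst /= cats0.
  rewrite twist_inv -twE => F.
  apply: (fill_class (w := twist (a + 1) [:: (y, false)] ++
    word_inv (twist a (word_subst thp [:: (y, false)])))).
    by rewrite pE /word_subst /= cats0.
  move: F; apply: fill_mono => [v|]; first by apply: ball_mono; nia.
  case: K {KP} => [|K]; first by rewrite !exp0n.
  by apply: leq_pexp2l; lia.
by rewrite d0.
Qed.

(** The coefficient b of c in a short expression of v is congruent to a modulo d. Replacing b by a
    costs (b - a) / d copies of c d, a fixed element of the span of qs. *)
Lemma ball_coordinate : exists K, forall rho v (a : int),
  reduced a -> span qs (v - c *~ a) -> ball (c :: qs) rho v ->
  (`|a| <= rho + d)%N /\ ball qs (K * rho.+1) (v - c *~ a).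
Proof.
have [K KP] := d_span; exists (K + 1)%N => rho v a ra va [b b_rho vb].
have ba : (b %% d)%Z = a.
  apply: reduced_unique => //; first exact: reduced_mod.
  rewrite /modz !mulrzBr.
  rewrite (_ : _ - _ = (v - c *~ a) - (v - c *~ b) - c *~ d *~ (b %/ d)%Z).
    by apply: spanB (spanB va (ex_intro _ _ vb)) (spanMz _ d_span).
  rewrite -mulrzA (mulrC (d : int)) opprB [(v - _) + _]addrC addrA subrK.
  by rewrite addrAC.
have k_b : (`|(b %/ d)%Z| <= `|b|)%N.
  have [->|d0] := eqVneq d 0%N; first by rewrite divz0.
  have := modz_ge0 b (d := d); have := ltz_mod b (d := d); have := divz_eq b d.
  rewrite ba; nia.
split.
  have [d0|d0] := eqVneq d 0%N; first by move: ba; rewrite d0 modz0 => <-; lia.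
  by have [i id ->] := reduced_nat d0 ra; rewrite absz_nat; lia.
rewrite -ba /modz mulrzBr opprB addrCA addrC.
rewrite (mulrC _ (d : int)) mulrzA.
apply: ball_mono (ballD vb (ballMz _ KP)); nia.
Qed.

(** A relator at height of size rho is read at an exponent of size at most rho + d, so its push has
    area exponential in rho and heights linear in rho. The base point moves from v to v - a c. *)
Lemma fill_push : exists M, forall rho v k w (a : int),
  reduced a -> span qs (v - c *~ a) ->
  fill h step_relators step_val (ball (c :: qs) rho) v k w ->
  filling (M * rho.+1) (v - c *~ a) (k * M ^ rho.+1) (push a w).
Proof.
have [K0 K0P] := ball_coordinate.
pose P r K := forall (a : int) p rho, reduced a -> ball qs rho p ->
  filling (rho + K * `|a|.+1) p (K ^ `|a|.+1) (push a r).
have [r m n mn Pm a p rho ra bp|r|K KP] := @uniform_bound_seq _ step_relators P.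
- apply: fill_mono (Pm _ _ _ ra bp) => [v|]; first by apply: ball_mono; nia.
  by elim: `|a|.+1%N => // i IH; rewrite !expnS leq_mul.
- exact: fill_push_relator.
(* The first two terms bound the heights and the last one the area, as |a| + 1 <= (d + 1)(rho +
   1). *)
pose M := (K0 + K * d.+1 + K.+1 ^ d.+1)%N.
exists M => rho v k w a ra va F.
elim: F a ra va => {v k w}.
- by move=> v a _ _; apply: fill_nil.
- move=> v r rR bv a ra va; rewrite mul1n.
  have [a_rho bva] := K0P _ _ _ ra va bv.
  apply: fill_mono (KP _ rR _ _ _ ra bva) => [u|].
    apply: ball_mono; rewrite /M !mulnDl -addnA leq_add2l.
    by apply: leq_trans (leq_addr _ _); rewrite -mulnA leq_mul2l; apply/orP; right; nia.
  apply: (@leq_trans ((K.+1 ^ d.+1) ^ rho.+1)); last first.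
    by rewrite leq_exp2r // leq_addl.
  rewrite -expnM; apply: (@leq_trans (K.+1 ^ `|a|.+1)); first by rewrite leq_exp2r.
  by apply: leq_pexp2l; nia.
- move=> v k w F IH a ra va.
  have [mw _] := push_null ra (fill_eval step_relator_val F).
  by apply: fill_class (fill_inv (IH _ ra va)); rewrite push_inv // pclass_inv.
- move=> v k l u w Fu IHu _ IHw a ra va.
  have [mu _] := push_null ra (fill_eval step_relator_val Fu).
  by rewrite push_cat mu mulnDl; apply: fill_cat; [apply: IHu|apply: IHw].
- move=> v k u w Fw IH a ra va.
  have rb := reduced_move u ra.
  have [mw _] := push_null rb (fill_eval step_relator_val Fw).
  apply: fill_class (esym (push_conj ra mw)) _; apply: fill_conj.
  (* The pushed path of u ends at the point obtained from the end of u by removing the power of t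
     reached there. *)
  have -> : v - c *~ a + height h g (push a u) =
      v + height h step_val u - c *~ (move a u).
    have := congr1 h (push_val u ra); rewrite !hM !height_zpow /height.
    move=> /(congr1 (fun x => x - c *~ (move a u))); rewrite addrK => ->.
    by rewrite addrA addrA -[v - _ + _]addrA addNr addr0.
  apply: IH => //.
  have := congr1 h (push_val u ra); rewrite !hM !height_zpow /height => E.
  rewrite (_ : _ - _ = (v - c *~ a) + h (word_eval g (push a u))).
    by apply: spanD => //; apply: height_g.
  move/(congr1 (fun x => x - c *~ (move a u))): E; rewrite addrK => ->.
  by rewrite addrA addrA -[v - _ + _]addrA addNr addr0.
- move=> v k w w' ww' _ IH a ra va.
  by have [E _] := push_free ra ww'; apply: fill_class E (IH _ ra va).
- by move=> v k k' w kk' _ IH a ra va; apply: fill_weaken (IH _ ra va); rewrite leq_mul2r kk' orbT.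
Qed.

End CyclicStep.

(** * Towers of cyclic extensions *)

Section Tower.
Local Open Scope ring_scope.
Variables (G : groupType) (V : zmodType) (h : G -> V).
Hypothesis hM : forall x y, h (x * y)%g = h x + h y.

(** The order of v modulo the span of qs, with d = 0 for infinite order; division with remainder by
    the least positive multiple gives divisibility. *)
Lemma span_order (qs : seq V) v : exists d : nat,
  span qs (v *~ d) /\ forall n : int, span qs (v *~ n) -> (d %| n)%Z.
Proof.
pose p (n : nat) := (0 < n)%N && `[< span qs (v *~ n) >].
have [exp|nexp] := pselect (exists n, p n); last first.
  exists 0%N; split; first exact: span0.
  move=> n sn; rewrite dvd0z; apply: contra_notT nexp => n0.
  exists `|n|%N; rewrite /p absz_gt0 n0; apply/asboolP.
  have [->|->] : (`|n|%N : int) = n \/ (`|n|%N : int) = - n by lia.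
    by [].
  by rewrite mulrNz; apply: spanN.
have [d /andP[d0 /asboolP sd] dmin] := ex_minnP exp.
exists d; split=> // n sn.
have sr : span qs (v *~ (n %% d)%Z).
  rewrite /modz mulrzBr; apply: spanB => //.
  by rewrite mulrC mulrzA; apply: spanMz.
have r0 := modz_ge0 n (d := d); have rd := ltz_mod n (d := d).
have [//|nr] := boolP (d %| n)%Z.
have [r rE] : exists r : nat, (n %% d)%Z = r.
  by exists `|(n %% d)%Z|%N; lia.
have /dmin : p r.
  rewrite /p -rE; apply/andP; split; last exact/asboolP.
  rewrite lt0n; apply: contra nr => /eqP r0'; apply/dvdz_mod0P; lia.
by move: rd; rewrite rE; lia.
Qed.

Lemma cyclic_step (qs : seq V) (t : G) (Y : finType) (S : seq (word Y)) (g : Y -> G) :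
  presents (fun x => span qs (h x)) S g ->
  exists (X : finType) (R : seq (word X)) (f : X -> G) (i : Y -> X) (M : nat),
    [/\ presents (fun x => span (h t :: qs) (h x)) R f,
        forall y, f (i y) = g y
      & forall rho k w,
          fill h R f (ball (h t :: qs) rho) 0 k (word_map i w) ->
          fill h S g (ball qs (M * rho.+1)) 0 (k * M ^ rho.+1) w].
Proof.
move=> g_presents; have [g_val g_gen _ _] := g_presents.
have conj_word x y : exists w, word_eval g w = (x * g y * x^-1)%g.
  apply: g_gen; rewrite !hM (homV hM) addrAC subrr add0r.
  by have := g_val [:: (y, false)]; rewrite word_eval_cons word_eval_nil mulg1.
have [thp thpE] := boolp.choice (conj_word t).
have [thm thmE] := boolp.choice (conj_word t^-1%g).
have {}thmE y : word_eval g (thm y) = (t^-1 * g y * t)%g by rewrite thmE invgK.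
have [d [d_span d_dvd]] := span_order qs (h t).
have wrap_word (a : int) : exists w, (d = 0%N -> w = [::]) /\
    word_eval g w = zpow t (a + 1 - ((a + 1) %% d)%Z).
  have [d0|d0] := eqVneq d 0%N.
    by exists [::]; rewrite d0 modz0 subrr word_eval_nil.
  have [|w wE] := g_gen (zpow t (a + 1 - ((a + 1) %% d)%Z)); last first.
    by exists w; split=> // /eqP; rewrite (negPf d0).
  rewrite (height_zpow hM) /modz subKr mulrC mulrzA; exact: spanMz.
have [e eP] := boolp.choice wrap_word.
have e_nil (d0 : d = 0%N) a : e a = [::] by have [E _] := eP a; apply: E.
have e_eval a := proj2 (eP a).
have [M MP] := fill_push hM g_presents thpE thmE d_span d_dvd e_eval e_nil.
exists (option Y), (step_relators S thp d e), (step_val t g), Some, M; split=> //.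
  exact: (step_presents hM).
(* At exponent 0 the twist is trivial, so a word in the old generators is pushed to itself. *)
move=> rho k w /(MP _ _ _ _ 0 (reduced0 d)); rewrite mulr0z subr0 push_map.
by apply; apply: span0.
Qed.

(** The cyclic steps are composed down to the kernel of h, where only the area is kept. Each step
    rescales heights linearly, so the composite factor remains exponential in rho. *)
Lemma tower (qs : seq V) (Y : finType) (S : seq (word Y)) (g : Y -> G) :
  (forall q, q \in qs -> exists t, h t = q) ->
  presents (fun x => span [::] (h x)) S g ->
  exists (X : finType) (R : seq (word X)) (f : X -> G) (i : Y -> X) (M : nat),
    [/\ presents (fun x => span qs (h x)) R f,
        forall y, f (i y) = g y
      & forall rho k w,
          fill h R f (ball qs rho) 0 k (word_map i w) ->
          fill h S g (fun=> True) 0 (k * M ^ rho.+1) w].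
Proof.
elim: qs => [|c qs IH] qs_im g_presents.
  exists Y, S, g, id, 1%N; split=> // rho k w.
  rewrite exp1n muln1 /word_map (eq_map (g := id)) ?map_id => [|[] //].
  exact: fill_mono.
have [|X [R [f [i [M [f_presents fi MP]]]]]] := IH _ g_presents.
  by move=> q q_qs; apply: qs_im; rewrite inE q_qs orbT.
have [t tc] := qs_im c (mem_head _ _).
have := cyclic_step t f_presents; rewrite tc.
move=> [X' [R' [f' [i' [M' [f'_presents fi' MP']]]]]].
exists X', R', f', (i' \o i), (M' * M.+1 ^ M'.+1)%N; split=> //.
  by move=> y; rewrite /= fi'.
move=> rho k w F.
have /MP' /MP : fill h R' f' (ball (c :: qs) rho) 0 k (word_map i' (word_map i w)).
  by move: F; rewrite /word_map -map_comp.
(* The upper step replaces rho by M' (rho + 1), and M' (rho + 1) + 1 <= (M' + 1)(rho + 1). *)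
apply: fill_mono => //; rewrite expnMn mulnA leq_mul2l -expnM; apply/orP; right.
apply: (@leq_trans (M.+1 ^ (M' * rho.+1).+1)); first by rewrite leq_exp2r.
by apply: leq_pexp2l => //; nia.
Qed.

End Tower.

(** * Two-tape transducers *)

Section Transducer.
Variables (A : Type) (S : finType).
Variables (step : S -> option A -> option A -> S -> Prop) (fin : S -> Prop).

(** A common model of both kinds of automata: a nondeterministic step reads at most one letter from
    each tape, and possibly none. *)
Inductive transducer_run : S -> seq A -> seq A -> Prop :=
| run_stop s : fin s -> transducer_run s [::] [::]
| run_step s o1 o2 s' w1 w2 :
    step s o1 o2 s' -> transducer_run s' w1 w2 ->
    transducer_run s (seq_of_opt o1 ++ w1) (seq_of_opt o2 ++ w2).

Definition right_step : rel S := fun s s' => `[< exists o, step s None o s' >].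

Lemma run_right_path p s w1 w2 :
  path right_step s p -> transducer_run (last s p) w1 w2 ->
  exists2 w2', transducer_run s w1 w2' & size w2' <= size p + size w2.
Proof.
elim: p s => [|s' p IH] s /=; first by exists w2.
move=> /andP[/asboolP[o so] ps'] /(IH _ ps')[w2' rw2' sw2'].
exists (seq_of_opt o ++ w2'); first exact: (run_step so rw2').
by rewrite size_cat; case: o {so} => [a|] /=; lia.
Qed.

Lemma run_first_left s w1 w2 : transducer_run s w1 w2 ->
  exists2 s', connect right_step s s' &
  if w1 is a :: w1' then exists o s'' w2', step s' (Some a) o s'' /\
    transducer_run s'' w1' w2'
  else fin s'.
Proof.
elim=> {s w1 w2} [s fs|s o1 o2 s' w1 w2 st rw [s'' ss'' E]]; first by exists s.
case: o1 st => [a|] st; first by exists s => //; exists o2, s', w2.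
exists s'' => //; apply: connect_trans ss''; apply: connect1.
by apply/asboolP; exists o2.
Qed.

(** Between two consecutive letters of the left word the run makes steps that read at most the right
    tape. Cutting the loops among them leaves fewer than #|S| such steps and keeps the left word. *)
Lemma run_short s w1 w2 : transducer_run s w1 w2 ->
  exists2 w2', transducer_run s w1 w2' & size w2' <= #|S| * (size w1).+1.
Proof.
have simple_path s1 s2 : connect right_step s1 s2 ->
    exists2 p, path right_step s1 p /\ last s1 p = s2 & size p < #|S|.
  move=> /connectP[p pp ->]; have [p' pp' up' _] := shortenP pp.
  by exists p' => //; have := max_card (mem (s1 :: p')); rewrite (card_uniqP up').
elim: w1 s w2 => [|a w1 IH] s w2 /run_first_left[s' /simple_path[p [pp lp] sp]].
  move=> fs'; have [|w2' r' s2'] := @run_right_path p s [::] [::] pp.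
    by rewrite lp; apply: run_stop.
  by exists w2' => //; apply: leq_trans s2' _; rewrite addn0 muln1 ltnW.
move=> [o [s'' [w2'' [st /IH[w3 r3 s3]]]]].
have [|w2' r' s2'] := @run_right_path p s (a :: w1) (seq_of_opt o ++ w3) pp.
  by rewrite lp; apply: (run_step st r3).
exists w2' => //; apply: leq_trans s2' _; rewrite size_cat addnA [leqRHS]mulnS.
apply: leq_add s3; apply: leq_trans sp.
by rewrite -addn1 leq_add2l; case: o {st}.
Qed.

End Transducer.

Definition rational (A : Type) (L : seq A -> seq A -> Prop) : Prop :=
  exists (S : finType) (step : S -> option A -> option A -> S -> Prop)
    (fin : S -> Prop) (s0 : S),
    forall w1 w2, L w1 w2 <-> transducer_run step fin s0 w1 w2.

(** * Multiplier automata recognize rational relations *)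

Section Synchronous.
Variables (A : Type) (M : dfa (option A * option A)).

Lemma pad_cons2 (a b : A) w1 w2 :
  pad (a :: w1) (b :: w2) = (Some a, Some b) :: pad w1 w2.
Proof.
by rewrite /pad /= maxnSS /mkseq /= (iotaDl 1 0) -map_comp; congr cons.
Qed.

Lemma pad_consl (a : A) w1 : pad (a :: w1) [::] = (Some a, None) :: pad w1 [::].
Proof.
rewrite /pad /= !maxn0 /mkseq /= (iotaDl 1 0) -map_comp; congr cons.
by apply: eq_map => i; rewrite /= !onth0n.
Qed.

Lemma pad_consr (b : A) w2 : pad [::] (b :: w2) = (None, Some b) :: pad [::] w2.
Proof.
rewrite /pad /= !max0n /mkseq /= (iotaDl 1 0) -map_comp; congr cons.
by apply: eq_map => i; rewrite /= !onth0n.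
Qed.

(* The two flags record which of the tapes have been read to their end. *)
Definition sync_step (s : dfa_state M * bool * bool) (o1 o2 : option A)
    (s' : dfa_state M * bool * bool) : Prop :=
  [/\ s' = (dfa_trans s.1.1 (o1, o2), ~~ o1, ~~ o2), o1 || o2,
      s.1.2 ==> ~~ o1 & s.2 ==> ~~ o2].

Definition sync_fin (s : dfa_state M * bool * bool) : Prop :=
  s.1.1 \in dfa_accept M.

(** A set flag forbids further letters on its tape, which reproduces the padding: after a None only
    None follows. *)
Lemma sync_runP s f1 f2 w1 w2 :
  transducer_run sync_step sync_fin (s, f1, f2) w1 w2 <->
  [/\ foldl (@dfa_trans _ M) s (pad w1 w2) \in dfa_accept M,
      f1 -> w1 = [::] & f2 -> w2 = [::]].
Proof.
split.
  move tE: (s, f1, f2) => t rt.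
  elim: rt s f1 f2 tE => {t w1 w2} [t ft|t o1 o2 t' w1 w2 [t'E o12 i1 i2] _ IH] s f1 f2 tE.
    by move: ft; rewrite -tE.
  subst t; have [] := IH _ _ _ (esym t'E) => acc e1 e2.
  move: i1 i2 o12 acc e1 e2 => /=.
  case: o1 {t'E IH} => [a|]; case: o2 => [b|] //=; case: f1; case: f2 => //= _ _ _ acc e1 e2.
  - by rewrite pad_cons2.
  - by move: acc; rewrite e2 // pad_consl.
  - by move: acc; rewrite e2 // pad_consl.
  - by move: acc; rewrite e1 // pad_consr.
  - by move: acc; rewrite e1 // pad_consr.
elim: w1 w2 s f1 f2 => [|a w1 IH] [|b w2] s f1 f2 [].
- by move=> acc _ _; apply: run_stop.
- elim: w2 b s f1 f2 => [|b' w2 IH] b s f1 f2; rewrite pad_consr => acc _ f2E.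
    have f2F : f2 = false by case: f2 f2E => // /(_ erefl).
    apply: (@run_step _ _ _ _ _ None (Some b) (dfa_trans s (None, Some b), true, false) [::] [::]).
      by split=> //=; rewrite ?f2F ?implybT.
    exact: run_stop.
  have f2F : f2 = false by case: f2 f2E => // /(_ erefl).
  apply: (@run_step _ _ _ _ _ None (Some b) (dfa_trans s (None, Some b), true, false) [::]).
    by split=> //=; rewrite ?f2F ?implybT.
  exact: IH.
- rewrite pad_consl => acc f1E _.
  have f1F : f1 = false by case: f1 f1E => // /(_ erefl).
  apply: (@run_step _ _ _ _ _ (Some a) None (dfa_trans s (Some a, None), false, true) w1 [::]).
    by split=> //=; rewrite ?f1F ?implybT.
  exact: IH.
rewrite pad_cons2 => acc f1E f2E.
have f1F : f1 = false by case: f1 f1E => // /(_ erefl).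
have f2F : f2 = false by case: f2 f2E => // /(_ erefl).
apply: (@run_step _ _ _ _ _ (Some a) (Some b) (dfa_trans s (Some a, Some b), false, false)).
  by split=> //=; rewrite ?f1F ?f2F.
exact: IH.
Qed.

Lemma sync_rational : rational (fun w1 w2 => dfa_lang M (pad w1 w2)).
Proof.
exists _, sync_step, sync_fin, (dfa_start M, false, false) => w1 w2.
by split=> [acc|/sync_runP[]//]; apply/sync_runP.
Qed.

End Synchronous.

Section Asynchronous.
Variables (A : Type) (M : async_dfa A).

(* The flag records whether the end marker has been read. *)
Definition tape (f : bool) (w : seq A) : seq (option A) :=
  if f then [::] else rcons (map Some w) None.

Definition async_step (s : async_state M * bool * bool) (o1 o2 : option A)
    (s' : async_state M * bool * bool) : Prop :=
  if async_left s.1.1 then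
    [/\ ~~ s.1.2, ~~ o2, s'.2 = s.2, s'.1.2 = ~~ o1
      & async_trans s.1.1 o1 = Some s'.1.1]
  else
    [/\ ~~ s.2, ~~ o1, s'.1.2 = s.1.2, s'.2 = ~~ o2
      & async_trans s.1.1 o2 = Some s'.1.1].

Definition async_fin (s : async_state M * bool * bool) : Prop :=
  [/\ s.1.1 \in async_accept M, s.1.2 & s.2].

(** Reading an end marker becomes a step that consumes no letter and sets the flag of that tape. *)
Lemma async_runP s f1 f2 w1 w2 :
  transducer_run async_step async_fin (s, f1, f2) w1 w2 <->
  [/\ async_run s (tape f1 w1) (tape f2 w2),
      f1 -> w1 = [::] & f2 -> w2 = [::]].
Proof.
split.
  move tE: (s, f1, f2) => t rt.
  elim: rt s f1 f2 tE => {t w1 w2} [t [ft t1 t2]|t o1 o2 [[s' f1'] f2'] w1 w2 st _ IH] s f1 f2 tE.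
    by move: ft t1 t2; rewrite -tE /= => ft -> ->; split=> //; apply: async_stop.
  subst t; have [] := IH _ _ _ erefl => acc e1 e2.
  move: st {IH}; rewrite /async_step /=; case: ifPn => ls [/= nf no fE oE tr].
    subst f2' f1'; case: o2 no => // _; case: f1 nf => // _.
    case: o1 tr acc e1 => [a|] /= tr acc e1; split=> //=.
    - exact: (async_read_left ls tr).
    - by rewrite e1 //; apply: (async_read_left ls tr).
  subst f2' f1'; case: o1 no => // _; case: f2 nf => // _.
  case: o2 tr acc e2 => [b|] /= tr acc e2; split=> //=.
  - exact: (async_read_right ls tr).
  - by rewrite e2 //; apply: (async_read_right ls tr).
case; move xE: (tape f1 w1) => x; move yE: (tape f2 w2) => y r.
elim: r w1 w2 f1 f2 xE yE => {s x y}.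
- move=> s acc w1 w2 f1 f2.
  case: f1 => [_|]; last by case: w1.
  case: f2 => [_|]; last by case: w2.
  by move=> -> // -> //; apply: run_stop.
- move=> s s' o x y ls tr _ IH w1 w2 [//|] f2 /=.
  case: w1 => [|a w1] /= [oE xE] yE _ e2; subst o.
    apply: (@run_step _ _ _ _ _ None None (s', true, f2) [::] w2).
      by rewrite /async_step /= ls.
    by apply: IH.
  apply: (@run_step _ _ _ _ _ (Some a) None (s', false, f2) w1 w2).
    by rewrite /async_step /= ls.
  by apply: IH.
move=> s s' o x y ls tr _ IH w1 w2 f1 [//|] /=.
case: w2 => [|b w2] /= xE [oE yE] e1 _; subst o.
  apply: (@run_step _ _ _ _ _ None None (s', f1, true) w1 [::]).
    by rewrite /async_step /= (negPf ls).
  by apply: IH.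
apply: (@run_step _ _ _ _ _ None (Some b) (s', f1, false) w1 w2).
  by rewrite /async_step /= (negPf ls).
by apply: IH.
Qed.

Lemma async_rational : rational (async_lang M).
Proof.
exists _, async_step, async_fin, (async_start M, false, false) => w1 w2.
by split=> [acc|/async_runP[]//]; apply/async_runP.
Qed.

End Asynchronous.

(** * Fillings in automatic groups *)

Section Combing.
Local Open Scope ring_scope.
Variables (G : groupType) (V : zmodType) (h : G -> V).
Hypothesis hM : forall x y, h (x * y)%g = h x + h y.
Variable qs : seq V.
Hypothesis h_span : forall x, span qs (h x).
Variables (X : finType) (R : seq (word X)) (f : X -> G).
Hypothesis f_presents : presents (fun x => span qs (h x)) R f.
Variables (A : finType) (pi : A -> G).
Variable wd : G -> word X.
Hypothesis wdE : forall x, word_eval f (wd x) = x.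

Local Notation filling rho := (fill h R f (ball qs rho)).

Definition ev (w : seq A) : G := (\prod_(a <- w) pi a)%g.

Definition spell (w : seq A) : word X := flatten [seq wd (pi a) | a <- w].

Lemma ev_cat u v : ev (u ++ v) = (ev u * ev v)%g.
Proof. by rewrite /ev big_cat. Qed.

Lemma ev_nil : ev [::] = 1%g. Proof. by rewrite /ev big_nil. Qed.

Lemma ev_seq1 a : ev [:: a] = pi a. Proof. by rewrite /ev big_seq1. Qed.

Lemma spell_cat u v : spell (u ++ v) = spell u ++ spell v.
Proof. by rewrite /spell map_cat flatten_cat. Qed.

Lemma spellE w : word_eval f (spell w) = ev w.
Proof.
elim: w => [|a w IH]; first by rewrite word_eval_nil ev_nil.
by rewrite -cat1s spell_cat ev_cat word_eval_cat IH /= /spell /= cats0 wdE ev_seq1.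
Qed.

Lemma fill_closed w : word_eval f w = 1%g ->
  exists K, forall p rho, ball qs rho p -> filling (rho + K) p K w.
Proof.
have [f_val _ _ pres] := f_presents.
by move=> /pres/(fill_relation f_val).
Qed.

Definition prefixes_in (n : nat) (x : G) (w : seq A) : Prop :=
  forall u v, w = u ++ v -> ball qs n (h (x * ev u)%g).

Lemma prefixes_in_mono m n x w : (m <= n)%N -> prefixes_in m x w -> prefixes_in n x w.
Proof. by move=> mn P u v /P; apply: ball_mono. Qed.

Lemma prefixes_in_nil n x : prefixes_in n x [::] <-> ball qs n (h x).
Proof.
split=> [/(_ [::] [::] erefl)|bx [|//] v _]; by rewrite ev_nil mulg1.
Qed.

Lemma prefixes_in_cons n x a w :
  prefixes_in n x (a :: w) <-> ball qs n (h x) /\ prefixes_in n (x * pi a)%g w.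
Proof.
split=> [P|[bx P] [|b u] v].
- split=> [|u v wE]; first by have := P [::] _ erefl; rewrite ev_nil mulg1.
  by have := P (a :: u) v; rewrite wE -(cat1s a u) ev_cat ev_seq1 mulgA; apply.
- by move=> _; rewrite ev_nil mulg1.
by case=> <- /P; rewrite -(cat1s a u) ev_cat ev_seq1 mulgA.
Qed.

Lemma prefixes_in_exists x w : exists n, prefixes_in n x w.
Proof.
elim: w x => [|a w IH] x.
  by have [n bn] := h_span x; exists n; apply/prefixes_in_nil.
have [n bn] := h_span x; have [m Pm] := IH (x * pi a)%g.
exists (m + n)%N; apply/prefixes_in_cons; split.
  by apply: ball_mono bn; apply: leq_addl.
by apply: prefixes_in_mono Pm; apply: leq_addr.
Qed.

(** * The strip between two words accepted together *)

Section Strip.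
Variables (x : G) (S : finType).
Variables (step : S -> option A -> option A -> S -> Prop) (fin : S -> Prop).
Local Notation run := (transducer_run step fin).

(* The state s is entered with the tapes standing at y1 and y2 in G. *)
Definition entered (s : S) (y1 y2 : G) : Prop :=
  forall w1 w2, run s w1 w2 -> (y1 * ev w1 * x = y2 * ev w2)%g.

Lemma entered_step s o1 o2 s' y1 y2 : entered s y1 y2 -> step s o1 o2 s' ->
  entered s' (y1 * ev (seq_of_opt o1))%g (y2 * ev (seq_of_opt o2))%g.
Proof.
move=> acc st w1 w2 r; have := acc _ _ (run_step st r).
by rewrite !ev_cat !mulgA.
Qed.

(** If s accepts the remaining words w1 and w2, then y1^-1 y2 = w1 x w2^-1. One accepted pair chosen
    for s thus determines the difference at every entry into s. *)
Lemma state_difference : exists delta : S -> G, forall s y1 y2 w1 w2,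
  entered s y1 y2 -> run s w1 w2 -> (y1 * delta s = y2)%g.
Proof.
suff /boolp.choice[delta deltaP] : forall s, exists z, forall y1 y2 w1 w2,
    entered s y1 y2 -> run s w1 w2 -> (y1 * z = y2)%g by exists delta.
move=> s; have [[[w1 w2] r]|none] := pselect (exists w, run s w.1 w.2).
  exists (ev w1 * x * (ev w2)^-1)%g => y1 y2 _ _ /(_ _ _ r) E _.
  by rewrite !mulgA E mulgK.
(* A state from which nothing is accepted gets the default value 1. *)
by exists 1%g => y1 y2 w1 w2 _ r; case: none; exists (w1, w2).
Qed.

(** The rungs [delta s] cut the strip into one cell per step of the run. There are finitely many
    cells, so their areas are bounded, and the right path stays within the heights of the rungs from
    the left one. *)
Lemma strip_fill : exists K, forall s y1 y2 w1 w2 rho,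
  run s w1 w2 -> entered s y1 y2 -> prefixes_in rho y1 w1 ->
  prefixes_in (rho + K) y2 w2 /\
  filling (rho + K) (h y1) (K * (size w1 + size w2).+1)
    (spell w1 ++ wd x ++ word_inv (spell w2) ++ word_inv (wd (y1^-1 * y2)%g)).
Proof.
have [delta deltaP] := state_difference.
have [|s|K1 K1P] := @uniform_bound S (fun s n => ball qs n (h (delta s))).
- by move=> s m n mn; apply: ball_mono.
- exact: h_span.
pose cell s (i : option A * option A * S) := spell (seq_of_opt i.1.1) ++ wd (delta i.2) ++
  word_inv (spell (seq_of_opt i.1.2)) ++ word_inv (wd (delta s)).
have [||K2 K2P] := @uniform_bound (S * (option A * option A * S))%type
  (fun i K => word_eval f (cell i.1 i.2) = 1%g -> forall p rho, ball qs rho p ->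
     filling (rho + K) p K (cell i.1 i.2)).
- move=> i m n mn Pm /Pm {}Pm p rho /Pm; apply: fill_mono => // v.
  by apply: ball_mono; rewrite leq_add2l.
- move=> i; have [/fill_closed[K KP]|ne] := pselect (word_eval f (cell i.1 i.2) = 1%g).
    by exists K.
  by exists 0%N.
have [|K3 K3P] := @fill_closed (wd x ++ word_inv (wd x)).
  by rewrite word_eval_cat word_eval_inv mulgV.
exists (K1 + K2 + K3)%N => s y1 y2 w1 w2 rho r.
have entered_ball s' z1 z2 u1 u2 : run s' u1 u2 -> entered s' z1 z2 ->
    prefixes_in rho z1 u1 -> ball qs (rho + (K1 + K2 + K3)) (h z2).
  move=> r' acc P; rewrite -(deltaP _ _ _ _ _ acc r') hM.
  have := ballD (P [::] _ erefl) (K1P s'); rewrite ev_nil mulg1.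
  by apply: ball_mono; lia.
elim: r y1 y2 => {s w1 w2} [s fs|s o1 o2 s' w1 w2 st r IH] y1 y2 acc P1.
  have r := run_stop step fs; split.
    by apply/prefixes_in_nil; apply: entered_ball r acc P1.
  have := acc _ _ r; rewrite !ev_nil !mulg1 => <-; rewrite mulKg /=.
  have b1 : ball qs rho (h y1) by apply/prefixes_in_nil.
  by apply: fill_mono (K3P _ _ b1) => [v|]; [apply: ball_mono|]; lia.
have acc' := entered_step acc st.
have rs := run_step st r.
have b1 : ball qs rho (h y1) by have := P1 [::] _ erefl; rewrite ev_nil mulg1.
have P1' : prefixes_in rho (y1 * ev (seq_of_opt o1))%g w1.
  case: (o1) P1 => [a|] /=; last by rewrite ev_nil mulg1.
  by rewrite ev_seq1 => /prefixes_in_cons[].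
have [P2 F] := IH _ _ acc' P1'; split.
  have b2 := entered_ball _ _ _ _ _ rs acc P1.
  case: (o2) P2 => [b|] /=; last by rewrite ev_nil mulg1.
  by rewrite ev_seq1 => P2; apply/prefixes_in_cons.
have d1 : (y1^-1 * y2 = delta s)%g by rewrite -(deltaP _ _ _ _ _ acc rs) mulKg.
have d2 : ((y1 * ev (seq_of_opt o1))^-1 * (y2 * ev (seq_of_opt o2)) = delta s')%g.
  by rewrite -(deltaP _ _ _ _ _ acc' r) mulKg.
move: F; rewrite d1 d2 => F.
have cell1 : word_eval f (cell s (o1, o2, s')) = 1%g.
  rewrite /cell !word_eval_cat !word_eval_inv !spellE !wdE -d1 -d2 /=.
  by rewrite !invgM !invgK !mulgA mulgV mul1g !mulgK mulVg.
have {}F : filling (rho + (K1 + K2 + K3)) (h y1)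
    ((K1 + K2 + K3) * (size w1 + size w2).+1)
    (spell (seq_of_opt o1) ++ (spell w1 ++ wd x ++ word_inv (spell w2) ++
      word_inv (wd (delta s'))) ++ word_inv (spell (seq_of_opt o1))).
  by apply: fill_conj; rewrite /height spellE -hM.
(* A step that reads nothing leaves the rung unchanged and adds no cell; so the area is bounded by
   the lengths of the words and not by that of the run. *)
have [[E1 E2]|ne] := pselect (o1 = None /\ o2 = None).
  subst o1 o2; move: F; rewrite /= cats0.
  have -> : delta s' = delta s by rewrite -d2 -d1 /= ev_nil !mulg1.
  by [].
have C := K2P (s, (o1, o2, s')) cell1 _ _ b1.
apply: (@fill_class _ _ _ _ _ _ _ _ _ ((spell (seq_of_opt o1) ++ (spell w1 ++ wd x ++
  word_inv (spell w2) ++ word_inv (wd (delta s'))) ++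
  word_inv (spell (seq_of_opt o1))) ++ cell s (o1, o2, s'))).
  by rewrite /cell !spell_cat /=; word_group.
apply: (@fill_weaken _ _ _ _ _ _ _ _
  ((K1 + K2 + K3) * (size w1 + size w2).+1 + (K1 + K2 + K3))%N).
  rewrite -mulnSr leq_mul2l; apply/orP; right.
  rewrite !size_cat; move: ne.
  by case: (o1) => [a|]; case: (o2) => [b|] ne /=; (lia || by case: ne).
apply: fill_cat F _; apply: fill_mono C => [v|]; last by lia.
by apply: ball_mono; lia.
Qed.

End Strip.

Variables (W : seq A -> Prop) (MX : option A -> seq A -> seq A -> Prop).
Hypothesis MX_rational : forall o, rational (MX o).
Hypothesis W_onto : forall x, exists2 w, W w & ev w = x.
Hypothesis MXE : forall o w1 w2,
  MX o w1 w2 <-> [/\ W w1, W w2 & (ev w1 * oapp pi 1 o = ev w2)%g].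

(** The strip between two paths from the identity. Its first rung [wd 1] is a null word that may be
    nonempty, and it is filled separately. *)
Lemma edge_strip : exists K, forall o w1 w2 rho,
  MX o w1 w2 -> prefixes_in rho 1%g w1 ->
  prefixes_in (rho + K) 1%g w2 /\
  filling (rho + K) 0 (K * (size w1 + size w2).+1)
    (spell w1 ++ wd (oapp pi 1%g o) ++ word_inv (spell w2)).
Proof.
pose P o K := forall w1 w2 rho, MX o w1 w2 -> prefixes_in rho 1%g w1 ->
  prefixes_in (rho + K) 1%g w2 /\ filling (rho + K) 0 (K * (size w1 + size w2).+1)
    (spell w1 ++ wd (oapp pi 1%g o) ++ word_inv (spell w2)).
have [o m n mn Pm w1 w2 rho L P1|o|K KP] := @uniform_bound (option A) P.
- have [P2 F] := Pm _ _ _ L P1; split.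
    by apply: prefixes_in_mono P2; rewrite leq_add2l.
  by apply: fill_mono F => [v|]; [apply: ball_mono; lia|rewrite leq_mul2r mn orbT].
- have [S [step [fin [s0 s0P]]]] := MX_rational o.
  have [K1 K1P] := strip_fill (oapp pi 1%g o) step fin.
  have [K2 K2P] := @fill_closed (wd 1%g) (wdE 1%g).
  exists (K1 + K2)%N => w1 w2 rho /s0P r P1.
  have [|P2] := K1P _ 1%g 1%g _ _ _ r _ P1.
    by move=> u1 u2 /s0P/MXE[_ _]; rewrite !mul1g.
  rewrite (hom1 hM) invg1 mulg1 => F; split.
    by apply: prefixes_in_mono P2; rewrite leq_add2l leq_addr.
  have b0 : ball qs rho 0 by apply: ball0.
  apply: (@fill_class _ _ _ _ _ _ _ _ _ ((spell w1 ++ wd (oapp pi 1%g o) ++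
    word_inv (spell w2) ++ word_inv (wd 1%g)) ++ wd 1%g)); first by word_group.
  apply: (@fill_weaken _ _ _ _ _ _ _ _ (K1 * (size w1 + size w2).+1 + K2)%N).
    by rewrite mulnDl leq_add2l leq_pmulr.
  by apply: fill_cat; [apply: fill_mono F => // v|apply: fill_mono (K2P _ _ b0) => // v];
    apply: ball_mono; lia.
by exists K.
Qed.

Lemma edge_short : exists K, forall o w1 w2, MX o w1 w2 ->
  exists2 w2', MX o w1 w2' & (size w2' <= K * (size w1).+1)%N.
Proof.
pose P o K := forall w1 w2, MX o w1 w2 ->
  exists2 w2', MX o w1 w2' & (size w2' <= K * (size w1).+1)%N.
have [o m n mn Pm w1 w2 /Pm[w L sw]|o|K KP] := @uniform_bound (option A) P.
- by exists w => //; apply: leq_trans sw _; rewrite leq_mul2r mn orbT.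
- have [S [step [fin [s0 s0P]]]] := MX_rational o.
  by exists #|S| => w1 w2 /s0P/run_short[w /s0P L sw]; exists w.
by exists K.
Qed.

(** The region bounded by w1, w and w2 is a stack of one strip per letter of w. From strip to strip
    the lengths grow by a factor and the heights by a summand, so area is exponential and height
    linear. *)
Lemma combing : exists2 B, (0 < B)%N & forall w w1 rho,
  W w1 -> prefixes_in rho 1%g w1 ->
  exists w2, [/\ W w2, ev w2 = (ev w1 * ev w)%g,
    prefixes_in (rho + B * size w) 1%g w2,
    ((size w2).+1 <= B ^ size w * (size w1).+1)%N
  & filling (rho + B * size w) 0 (size w * B ^ size w * (size w1).+1)
      (spell w1 ++ spell w ++ word_inv (spell w2))].
Proof.
have [K KP] := edge_strip; have [L LP] := edge_short.
exists ((K * L.+1) + K + L).+1 => //; set B := _.+1.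
elim=> [|a w IH] w1 rho W1 P1.
  exists w1; split=> //; rewrite ?ev_nil ?mulg1 ?muln0 ?addn0 ?mul1n //.
  by apply: fill_trivial; word_group.
(* The representative v of the next vertex may be long; [edge_short] replaces it by one of length
   linear in that of w1. *)
have [v Wv vE] := W_onto (ev w1 * pi a)%g.
have [|wa La size_wa] := LP (Some a) w1 v; first by apply/MXE.
have [_ Wa /= waE] := (MXE _ _ _).1 La.
have [Pa Fa] := KP _ _ _ _ La P1.
have [w2 [W2 w2E P2 size_w2 F2]] := IH _ _ Wa Pa.
have size_a : ((size wa).+1 <= B * (size w1).+1)%N.
  by rewrite /B; nia.
exists w2; split=> //.
- by rewrite w2E -waE -mulgA -(cat1s a) ev_cat ev_seq1.
- by apply: prefixes_in_mono P2 => /=; rewrite /B mulnS; lia.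
- by apply: leq_trans size_w2 _; rewrite /= expnSr -mulnA leq_mul2l size_a orbT.
apply: (@fill_class _ _ _ _ _ _ _ _ _ ((spell w1 ++ wd (pi a) ++ word_inv (spell wa)) ++
  (spell wa ++ spell w ++ word_inv (spell w2)))).
  by rewrite -(cat1s a) spell_cat /spell /= cats0 -/(spell _); word_group.
apply: (@fill_weaken _ _ _ _ _ _ _ _ (K * (size w1 + size wa).+1 +
  size w * B ^ size w * (size wa).+1)%N).
  rewrite /= mulSn mulnDl; apply: leq_add.
    apply: (@leq_trans (B * (size w1).+1)); first by rewrite /B; nia.
    by rewrite leq_mul2r expnS leq_pmulr ?expn_gt0.
  by rewrite expnSr -!mulnA !leq_mul2l size_a !orbT.
apply: fill_cat.
  by apply: fill_mono Fa => // u; apply: ball_mono; rewrite /= /B mulnS; lia.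
by apply: fill_mono F2 => // u; apply: ball_mono; rewrite /= /B mulnS; lia.
Qed.

(** The combing of a loop starts at a fixed representative w0 of 1 and ends at some w2 that also
    represents 1; a strip for the trivial generator joins w2 to w0. *)
Lemma spell_fill : exists C, forall w, ev w = 1%g ->
  filling (C * (size w).+1) 0 (C ^ (size w).+1) (spell w).
Proof.
have [B B0 BP] := combing; have [K KP] := edge_strip.
have [w0 W0 w0E] := W_onto 1%g.
have [rho P0] := prefixes_in_exists 1%g w0.
have [K1 K1P] := @fill_closed (wd 1%g) (wdE 1%g).
exists (rho + B + K + K1 + 2 * B * ((size w0).+1 * (2 * K + K1 + 1)))%N => w w1.
have [w2 [W2 w2E P2 size_w2 F2]] := BP w w0 rho W0 P0.
have [|_ F3] := KP None w2 w0 _ _ P2.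
  by apply/MXE; split=> //; rewrite w2E w1 w0E !mulg1.
pose rho' := (rho + B * size w + K + K1)%N.
have F : filling rho' 0 (size w * B ^ size w * (size w0).+1 +
    (K * (size w2 + size w0).+1 + K1))%N (spell w).
  have wd1 : filling rho' 0 K1 (word_inv (wd 1%g)).
    have b0 : ball qs rho 0 by apply: ball0.
    by apply: fill_inv; apply: fill_mono (K1P _ _ b0) => // u; apply: ball_mono;
      rewrite /rho'; lia.
  (* Conjugated by w0, the loop splits into the combing, the closing strip, and a conjugate of the
     inverse of [wd 1]. *)
  apply: (@fill_class _ _ _ _ _ _ _ _ _ (word_inv (spell w0) ++ ((spell w0 ++ spell w ++
      word_inv (spell w2)) ++ ((spell w2 ++ wd 1%g ++ word_inv (spell w0)) ++
    (spell w0 ++ word_inv (wd 1%g) ++ word_inv (spell w0)))) ++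
    word_inv (word_inv (spell w0)))); first by word_group.
  have w0_height : height h f (spell w0) = 0 by rewrite /height spellE w0E (hom1 hM).
  apply: fill_conj; rewrite (heightN hM) w0_height subr0.
  apply: fill_cat; first by apply: fill_mono F2 => // u; apply: ball_mono; rewrite /rho'; lia.
  apply: fill_cat; first by apply: fill_mono F3 => // u; apply: ball_mono; rewrite /rho'; lia.
  by apply: fill_conj; rewrite w0_height addr0.
apply: fill_mono F => [u|].
  by apply: ball_mono; rewrite /rho'; nia.
set n := size w; set s := (size w0).+1; set D := (2 * K + K1 + 1)%N.
have Bn : (0 < B ^ n)%N by rewrite expn_gt0 B0.
(* The number of strips, linear in n, is absorbed into the base of the exponential. *)
have n2 : (n.+1 <= 2 ^ n)%N by apply: ltn_expl.
apply: (@leq_trans (s * D * (2 * B) ^ n)).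
  apply: (@leq_trans (n.+1 * D * B ^ n * s)).
    have : ((size w2 + size w0).+1 <= 2 * (B ^ n * s))%N.
      by move: size_w2; rewrite -/n /s; nia.
    by rewrite /D; move: (B ^ n)%N Bn => b b0; rewrite {1}/s; nia.
  by rewrite expnMn; move: (B ^ n)%N (2 ^ n)%N n2 => b c; nia.
rewrite expnS; apply: leq_mul.
  by rewrite /D /s; nia.
have [->//|n0] := posnP n.
by rewrite leq_exp2r // /D /s; nia.
Qed.

(** Change of alphabet: each letter of X and each inverse is replaced by a word over A of bounded
    length, at a cost linear in the length of w. *)
Lemma null_word_fill : exists C, forall w, word_eval f w = 1%g ->
  filling (C * (size w).+1) 0 (C ^ (size w).+1) w.
Proof.
have [C CP] := spell_fill.
have /boolp.choice[tau tauE] : forall l : X * bool, exists u, ev u = word_eval f [:: l].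
  by move=> l; have [u _ uE] := W_onto (word_eval f [:: l]); exists u.
pose T (w : word X) := flatten (map tau w).
have T_ev w : ev (T w) = word_eval f w.
  elim: w => [|l w IH]; first by rewrite ev_nil word_eval_nil.
  by rewrite /T /= ev_cat tauE -/(T w) IH -word_eval_cat.
have [|l|b bP] := @uniform_bound (X * bool)%type (fun l n => (size (tau l) <= n)%N).
- by move=> l m n mn lm; apply: leq_trans mn.
- by exists (size (tau l)).
have T_size w : (size (T w) <= b * size w)%N.
  by elim: w => //= l w IH; rewrite /T /= size_cat mulnS leq_add.
have [|l|H HP] := @uniform_bound (X * bool)%type (fun l n => ball qs n (height h f [:: l])).
- by move=> l m n mn; apply: ball_mono.
- exact: h_span.
have [l m n mn Pm p rho /Pm|l|K KP] := @uniform_bound (X * bool)%type (fun l K =>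
  forall p rho, ball qs rho p ->
    filling (rho + K) p K ([:: l] ++ word_inv (spell (tau l)))).
- by apply: fill_mono => // v; apply: ball_mono; rewrite leq_add2l.
- apply: fill_closed.
  by rewrite word_eval_cat word_eval_inv spellE tauE mulgV.
(* The region between w and its translation consists of one bounded piece per letter, attached along
   w, where the height changes by at most H per letter. *)
have change_letters w q rho : ball qs rho q ->
    filling (rho + H * size w + K) q (K * size w) (w ++ word_inv (spell (T w))).
  elim: w q rho => [|l w IH] q rho bq; first by apply: fill_trivial; word_group.
  apply: (@fill_class _ _ _ _ _ _ _ _ _
    (([:: l] ++ (w ++ word_inv (spell (T w))) ++ word_inv [:: l]) ++
     ([:: l] ++ word_inv (spell (tau l))))).
    have -> : T (l :: w) = tau l ++ T w by [].
    by rewrite -[l :: w]cat1s spell_cat; word_group.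
  apply: (@fill_weaken _ _ _ _ _ _ _ _ (K * size w + K)%N).
    by rewrite [size (l :: w)]/= mulnS addnC.
  apply: fill_cat.
    apply: fill_conj; apply: fill_mono (IH _ _ (ballD bq (HP l))) => // v.
    by apply: ball_mono; rewrite /= mulnS; lia.
  by apply: fill_mono (KP l _ _ bq) => // v; apply: ball_mono; rewrite /= mulnS; lia.
exists (H + K + C.+1 * b.+1 + (K + 1) * C.+1 ^ b.+1)%N => w w1.
have F1 := change_letters w 0 0%N (ball0 _ _).
have F2 := CP (T w) (etrans (T_ev w) w1).
apply: (@fill_class _ _ _ _ _ _ _ _ _ ((w ++ word_inv (spell (T w))) ++ spell (T w))).
  by word_group.
set n := size w; set n' := size (T w) in F2.
have n'n : (n'.+1 <= b.+1 * n.+1)%N by have := T_size w; rewrite -/n -/n'; nia.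
apply: (@fill_weaken _ _ _ _ _ _ _ _ (K * n + C ^ n'.+1)%N); last first.
  apply: fill_cat; [apply: fill_mono F1|apply: fill_mono F2] => // v;
    by apply: ball_mono; rewrite -/n ?/n'; nia.
set D := (C.+1 ^ b.+1)%N.
have D0 : (0 < D)%N by rewrite expn_gt0.
have CD : (C ^ n'.+1 <= D ^ n.+1)%N.
  apply: (@leq_trans (C.+1 ^ n'.+1)); first by rewrite leq_exp2r.
  by rewrite -expnM leq_pexp2l.
apply: (@leq_trans (((K + 1) * D) ^ n.+1)); last by rewrite leq_exp2r // leq_addl.
have Dn : (0 < D ^ n.+1)%N by rewrite expn_gt0 D0.
have Kn : (K * n + 1 <= (K + 1) ^ n.+1)%N.
  elim: (n) => [|i IH]; first by rewrite muln0 expn_gt0 addn1.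
  by rewrite expnS; nia.
rewrite expnMn; apply: leq_trans (leq_add (leqnn _) CD) _.
by move: (D ^ n.+1)%N ((K + 1) ^ n.+1)%N Dn Kn => x y; nia.
Qed.

End Combing.

(** * The kernel *)

Lemma relator_product_class (X : choiceType) (R : seq (word X)) k w :
  relator_product R k w -> pclass R w = 1%g.
Proof.
move=> [s [_ sR /(pclass_free R)->]] {k w}; elim: s sR => [|[u r] s IH] sR //=.
rewrite pclass_cat IH ?mulg1 => [|v t st]; last by apply: (sR v); rewrite inE st orbT.
have r1 : pclass R r = 1%g.
  have := sR u r (mem_head _ _); rewrite mem_cat => /orP[/pclass_relator //|].
  by move=> /mapP[r' /pclass_relator E ->]; rewrite pclass_inv E invg1.
by rewrite !pclass_cat r1; word_group.
Qed.

(** * Operations on products of conjugates of relators *)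

Section RelatorProduct.
Variables (X : choiceType) (R : seq (word X)).

Lemma relator_product_relator r : r \in R -> relator_product R 1 r.
Proof.
move=> rR; exists [:: ([::], r)]; split=> // [u r'|].
  by rewrite inE => /eqP[_ ->]; rewrite mem_cat rR.
by rewrite /= !cats0; apply: free_eq_refl.
Qed.

Lemma relator_product_free k w w' :
  free_eq w w' -> relator_product R k w -> relator_product R k w'.
Proof.
move=> ww' [s [sk sR ws]]; exists s; split=> //.
exact: free_eq_trans (free_eq_sym ww') ws.
Qed.

Lemma relator_product_cat k l u v : relator_product R k u ->
  relator_product R l v -> relator_product R (k + l) (u ++ v).
Proof.
move=> [s [sk sR us]] [t [tl tR vt]]; exists (s ++ t); split.
- by rewrite size_cat sk tl.
- by move=> x r; rewrite mem_cat => /orP[/sR|/tR].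
apply: free_eqP; rewrite map_cat flatten_cat !pclass_cat.
by rewrite (pclass_free _ us) (pclass_free _ vt).
Qed.

Lemma relator_product_conj k u w : relator_product R k w ->
  relator_product R k (u ++ w ++ word_inv u).
Proof.
move=> [s [sk sR ws]]; exists [seq (u ++ p.1, p.2) | p <- s]; split.
- by rewrite size_map.
- by move=> x r /mapP[[y r'] /sR yr' [_ ->]].
apply: free_eqP; rewrite !pclass_cat (pclass_free _ ws) {ws sR sk}.
elim: s => [|p s IH] /=; first by word_group.
move: IH; rewrite !pclass_cat => <-.
by rewrite word_inv_cat; word_group.
Qed.

Lemma relator_product_inv k w : relator_product R k w ->
  relator_product R k (word_inv w).
Proof.
move=> [s [sk sR ws]]; exists (rev [seq (p.1, word_inv p.2) | p <- s]); split.
- by rewrite size_rev size_map.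
- move=> x r; rewrite mem_rev => /mapP[[y r'] /sR + [_ ->]] /=.
  rewrite !mem_cat => /orP[r'R|/mapP[r'' r''R ->]].
    by rewrite (map_f (@word_inv X)) ?orbT.
  by rewrite word_invK r''R.
apply: free_eqP; rewrite pclass_inv (pclass_free _ ws) {ws sR sk}.
elim: s => [|p s IH] /=; first by word_group.
rewrite rev_cons map_rcons flatten_rcons !pclass_cat -IH.
by word_group.
Qed.

End RelatorProduct.

(** Forgets the heights. A filling bounds the number of relators from above while [relator_product]
    counts it exactly, hence k'. *)
Lemma fill_relator_product (G : groupType) (V : zmodType) (h : G -> V)
    (X : choiceType) (R : seq (word X)) (f : X -> G) Adm q k w :
  fill h R f Adm q k w -> exists2 k', k' <= k & relator_product R k' w.
Proof.
elim=> {q k w}.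
- by move=> _; exists 0 => //; exists [::]; split=> //; apply: free_eq_refl.
- by move=> _ r rR _; exists 1 => //; apply: relator_product_relator.
- by move=> _ k w _ [k' k'k P]; exists k' => //; apply: relator_product_inv.
- move=> _ k l u v _ [k' k'k Pu] _ [l' l'l Pv]; exists (k' + l'); first exact: leq_add.
  exact: relator_product_cat.
- by move=> _ k u w _ [k' k'k P]; exists k' => //; apply: relator_product_conj.
- by move=> _ k w w' ww' _ [k' k'k P]; exists k' => //; apply: relator_product_free P.
- by move=> _ k l w kl _ [k' k'k P]; exists k' => //; apply: leq_trans kl.
Qed.

(** * Upper bounds for area and Dehn function *)

Section DehnBounds.
Variables (H : groupType) (P : finite_presentation H).

Lemma area_min (w : word (generator P)) k : relator_product (relators P) k w -> area w <= k.
Proof.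
move=> Pk; rewrite /area; case: pselect => // e.
by case: ex_minnP => m _; apply; apply/asboolP.
Qed.

Lemma dehn_le (F : nat -> nat) n :
  (forall w : word (generator P), size w <= n -> null_homotopic w -> area w <= F n) ->
  dehn P n <= F n.
Proof.
move=> aF; apply/bigmax_leqP => m _; apply/bigmax_leqP => w /asboolP null_w.
by apply: aF => //; rewrite size_tuple -ltnS.
Qed.

End DehnBounds.

Lemma abelian_zmodule (Q : groupType) : abelian_group Q ->
  exists (V : zmodType) (i : Q -> V),
    (forall x y, i (x * y)%g = (i x + i y)%R) /\ injective i.
Proof.
move=> abQ.
pose m := GRing.isZmodule.Build Q (@mulgA Q) abQ (@mul1g Q) (@mulVg Q).
pose V : zmodType := HB.pack (Group.sort Q) m.
by exists V, (fun x => x); split=> [x y|x y xy].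
Qed.

Lemma automatic_rational (G : groupType) :
  automatic G \/ asynchronously_automatic G ->
  exists (A : finType) (pi : A -> G) (W : seq A -> Prop)
    (MX : option A -> seq A -> seq A -> Prop),
    automatic_axioms pi W MX /\ forall o, rational (MX o).
Proof.
move=> [[A [pi [W [MX ax]]]]|[A [pi [W [MX ax]]]]].
  exists A, pi, (fun w => dfa_lang W w), (fun x w1 w2 => dfa_lang (MX x) (pad w1 w2)).
  by split=> // o; apply: sync_rational.
exists A, pi, (fun w => dfa_lang W w), (fun x => async_lang (MX x)).
by split=> // o; apply: async_rational.
Qed.

Section KernelPresentation.
Variables (G Q : groupType) (phi : {multiplicative G -> Q}).
Variables (V : zmodType) (i : Q -> V).
Hypothesis iM : forall x y, i (x * y)%g = (i x + i y)%R.
Hypothesis i_inj : injective i.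
Variable P : finite_presentation (kernel phi).

(** The span of the empty list is 0, so the kernel is the bottom stage of the tower. *)
Lemma kernel_presents :
  presents (fun x => span [::] (i (phi x))) (relators P) (@ker_val _ _ phi \o @gen_val _ P).
Proof.
have i1 : i 1%g = 0%R by apply: (addrI (i 1%g)); rewrite -iM mulg1 addr0.
have valE w : word_eval (@ker_val _ _ phi \o @gen_val _ P) w =
    ker_val (word_eval (@gen_val _ P) w).
  by rewrite -(@word_eval_morph _ _ _ _ (@ker_val _ _ phi)).
split.
- move=> w; exists 0; rewrite valE /=; case: (word_eval _ w) => x /= /eqP ->.
  exact: i1.
- move=> x [n /= x0].
  have phi_x : ker_pred phi x by apply/eqP/i_inj; rewrite x0 i1.
  have [w wE] := @gen_val_generates _ P (Kernel phi_x).
  by exists w; rewrite valE wE.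
- move=> r rR; rewrite valE.
  by have [_ -> //] := @gen_val_relations _ P r; exists 1; apply: relator_product_relator.
move=> w; rewrite valE => w1.
have /gen_val_relations[k /relator_product_class //] : word_eval (@gen_val _ P) w = 1%g.
exact: val_inj.
Qed.

End KernelPresentation.

Local Open Scope ring_scope.

Theorem corollary1p3 (R : realType) (G Q : groupType)
    (phi : {multiplicative G -> Q}) :
  finitely_presented G ->
  automatic G \/ asynchronously_automatic G ->
  finitely_generated Q ->
  abelian_group Q ->
  forall P : finite_presentation (kernel phi),
    exists C : R, 1 < C /\ forall n : nat, (dehn P n)%:R <= C ^+ n.
Proof.
move=> _ /automatic_rational[A [pi [W [MX [[W_onto MXE] MX_rational]]]]] _ abQ P.
have [V [i [iM i_inj]]] := abelian_zmodule abQ.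
pose h x := i (phi x).
have hM x y : h (x * y)%g = h x + h y by rewrite /h gmulfM iM.
(* The images of the letters of A span the image of h, because every element of G is a product of
   letters. *)
pose qs := [seq h (pi a) | a <- enum A].
have h_span x : span qs (h x).
  have [w _ <-] := W_onto x; elim: w => [|a w IH].
    by rewrite big_nil (hom1 hM); apply: span0.
  rewrite big_cons hM; apply: spanD => //; apply: span_mem.
  by apply: (map_f (fun a => h (pi a))); rewrite mem_enum.
(* As qs spans all heights, the top stage of this tower presents the whole of G. *)
have [|X [S [f [j [M [f_presents fj MP]]]]]] := tower hM (qs := qs) _ (kernel_presents iM i_inj P).
  by move=> q /mapP[a _ ->]; exists (pi a).
have [f_val f_gen _ _] := f_presents.
have /boolp.choice[wd wdE] : forall x, exists w, word_eval f w = x.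
  by move=> x; apply: f_gen.
have [K KP] := null_word_fill hM h_span f_presents wdE MX_rational W_onto MXE.
have area_bound (w : word (generator P)) : null_homotopic w ->
    (area w <= K ^ (size w).+1 * M ^ (K * (size w).+1).+1)%N.
  move=> null_w; have jw1 : word_eval f (word_map j w) = 1%g.
    rewrite word_eval_map (eq_word_eval (g := @ker_val _ _ phi \o @gen_val _ P)) //.
    rewrite -(@word_eval_morph _ _ _ _ (@ker_val _ _ phi)) //.
    by rewrite null_w.
  have := KP _ jw1; rewrite size_map => /MP/fill_relator_product[k kle /area_min a_k].
  exact: leq_trans kle.
(* The area is at most E^(l + 1) for words of length l, and l + 1 <= 2 l for l > 0; hence the base
   E^2. *)
pose E := (K * M.+1 ^ K.+1).+2.
exists ((E ^ 2)%:R); split; first by rewrite ltr1n -(exp1n 2) ltn_exp2r.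
move=> n; rewrite -natrX ler_nat; apply: (dehn_le (F := expn (E ^ 2))) => w sw null_w.
(* For the empty word E^(l + 1) would exceed C^0 = 1, so its area is shown to be 0. *)
have [/eqP w0|w_gt0] := posnP (size w).
  move: null_w sw; rewrite (size0nil (eqP w0)) => _ _.
  apply: (@leq_trans 0%N) => //; apply: area_min.
  by exists [::]; split=> //; apply: free_eq_refl.
apply: leq_trans (area_bound _ null_w) _.
apply: (@leq_trans (E ^ (size w).+1)); last first.
  by rewrite -expnM leq_pexp2l //; lia.
apply: (@leq_trans ((K * M.+1 ^ K.+1) ^ (size w).+1)); last by rewrite leq_exp2r // /E; lia.
rewrite expnMn leq_mul2l -expnM; apply/orP; right.
apply: (@leq_trans (M.+1 ^ (K * (size w).+1).+1)); first by rewrite leq_exp2r.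
by apply: leq_pexp2l => //; nia.
Qed.
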